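(* Let $n$ be a natural number. For every precubical set $P$ having a locally ordered realization $|P|_{lo}$, $$|P|_{lo}\cong(\mathbb R^n,\leqslant^n)\quad\Longrightarrow\quad P\cong R^{\otimes n},$$ where the first isomorphism is one of locally ordered spaces, $\leqslant^n$ is the product order, and the second is an isomorphism of precubical sets (up to symmetry).
   Context: Local orders. An ordered space is a topological space with a partial order. An ordered base $\mathcal B$ of a space $X$ is a collection of posets whose underlying sets form a base of the topology and such that for $B,B'\in\mathcal B$, $x\in B\cap B'$ there is $B''\in\mathcal B$ with $x\in B''\subseteq B\cap B'$, a subposet of both. A locally ordered space is a space with an ordered base, whose elements are called ordered open sets; an ordered neighborhood of $x$ is an ordered open set containing $x$. Open subsets of ordered open sets, with the induced order, are also regarded as ordered open sets. A morphism is a continuous $f:X\to Y$ such that for every $x$ and ordered neighborhood $V$ of $f(x)$ there is an ordered neighborhood $U$ of $x$ with $f(U)\subseteq V$ and $f|_U$ order preserving. An ordered space such as $(\mathbb R^n,\leqslant^n)$ is seen as a locally ordered space via its open subsets with the induced order. Precubical sets. A precubical set $P$ consists of sets $P_k$ ($k\in\mathbb N$) of $k$-cubes and face maps $\delta^\epsilon_{k,i}:P_k\to P_{k-1}$ ($\epsilon\in\{-,+\}$, $0\le i<k$) satisfying $\delta^\epsilon_{k,j}\delta^\eta_{k+1,i}=\delta^\eta_{k,i}\delta^\epsilon_{k+1,j+1}$ for $i\le j$. Faces obtained by applying only $\delta^-$'s (resp. $\delta^+$'s) are lower (resp. upper) faces; a vertex which is a lower (resp. upper) face of a cube is its minimum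 (resp. maximum). Two cubes are adjacent if one is a face of the other. A graph is a precubical set of dimension at most $1$ ($\delta^-=$ source, $\delta^+=$ target). $(P\otimes Q)_m=\bigsqcup_{i+j=m}P_i\times Q_j$ with the evident faces. Isomorphism ($\cong$) of precubical sets means isomorphism of the associated (freely generated) symmetric precubical sets, i.e. one is allowed to permute the directions of cubes. $R$ is the graph with $R_0=\mathbb Z$, $R_1=\mathbb Z$, source $x\mapsto x$ and target $x\mapsto x+1$. The geometric realization $|P|$ has underlying set $\bigsqcup_kP_k\times]0,1[^k$. A locally ordered realization $|P|_{lo}$ is a locally ordered space with ordered base $\mathcal B$ such that: (i) its underlying space is $|P|$; (ii) for each $B\in\mathcal B$, the relation ''there is a path (in $B$) from $x$ to $y$ which is increasing on each cube it traverses'' is a partial order and is the order of $B$; (iii) for $B\in\mathcal B$, $x,y\in B$ with $x\in\{c\}\times]0,1[^{\dim c}$, $y\in\{c'\}\times]0,1[^{\dim c'}$, $c$ a lower (resp. upper) face of $c'$ and the segment $]x,y[$ (resp. $]y,x[$) directed in $\{c'\}\times]0,1[^{\dim c'}$, one has $x\le y$ (resp. $y\le x$) in $B$; (iv) every ordered neighborhood $B$ of a vertex $v$ only intersects (open) cubes adjacent to $v$, and for every cube $c$ with minimum (resp. maximum) $v$ and $x\in B\cap\{c\}\times]0,1[^{\dim c}$, every $y\ge x$ (resp. $y\le x$) in $B$ lies in $\{c'\}\times]0,1[^{\dim c'}$ for some $c'$ having $c$ as lower (resp. upper) face (or $c'=c$). It is unique up to isomorphism if it exists. *)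

(* Defs.v *)
From HB Require Import structures.
From mathcomp Require Import all_boot all_order all_algebra all_fingroup.
From mathcomp Require Import all_classical all_reals all_analysis.
From mathcomp Require Import zify.

Set Implicit Arguments.
Unset Strict Implicit.
Unset Printing Implicit Defensive.

Import Order.TTheory GRing.Theory Num.Theory.
Import numFieldNormedType.Exports.
Local Open Scope classical_set_scope.
Local Open Scope ring_scope.

(* A poset whose underlying set is a subset of X; ple is meaningless outside
   of carrier. *)
Record local_poset (X : Type) := LocalPoset {
  carrier : set X;
  ple : X -> X -> Prop;
  ple_refl : forall x, carrier x -> ple x x;
  ple_antisym : forall x y, carrier x -> carrier y ->
    ple x y -> ple y x -> x = y;
  ple_trans : forall x y z, carrier x -> carrier y -> carrier z ->
    ple x y -> ple y z -> ple x z
}.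

Definition subposet (X : Type) (A B : local_poset X) : Prop :=
  carrier A `<=` carrier B /\
  forall x y, carrier A x -> carrier A y -> (ple A x y <-> ple B x y).

Record ordered_base (X : topologicalType) := OrderedBase {
  base_elt : set (local_poset X);
  base_basis : basis (@carrier X @` base_elt);
  base_directed : forall B B' x, base_elt B -> base_elt B' ->
    carrier B x -> carrier B' x ->
    exists B'', [/\ base_elt B'', carrier B'' x, subposet B'' B
                  & subposet B'' B']
}.

(* Open subsets of elements of the base, with the induced order, count as
   ordered open sets. *)
Definition ordered_open (X : topologicalType) (L : ordered_base X)
    (U : local_poset X) : Prop :=
  open (carrier U) /\ exists2 B, base_elt L B & subposet U B.

Definition ordered_nbhd (X : topologicalType) (L : ordered_base X) (x : X)
    (U : local_poset X) : Prop :=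
  ordered_open L U /\ carrier U x.

Definition lo_morphism (X Y : topologicalType) (LX : ordered_base X)
    (LY : ordered_base Y) (f : X -> Y) : Prop :=
  continuous f /\
  forall x V, ordered_nbhd LY (f x) V ->
    exists U, [/\ ordered_nbhd LX x U,
      f @` carrier U `<=` carrier V
    & forall y z, carrier U y -> carrier U z ->
        ple U y z -> ple V (f y) (f z)].

Definition lo_isomorphic (X Y : topologicalType) (LX : ordered_base X)
    (LY : ordered_base Y) : Prop :=
  exists (f : X -> Y) (g : Y -> X),
    [/\ lo_morphism LX LY f, lo_morphism LY LX g, cancel f g & cancel g f].

Section OrderedSpace.
Variables (X : topologicalType) (le : X -> X -> Prop).
Hypothesis le_refl : forall x, le x x.
Hypothesis le_antisym : forall x y, le x y -> le y x -> x = y.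
Hypothesis le_trans : forall x y z, le x y -> le y z -> le x z.

Definition induced_poset (U : set X) : local_poset X :=
  @LocalPoset X U le (fun x _ => le_refl x) (fun x y _ _ => @le_antisym x y)
    (fun x y z _ _ _ => @le_trans x y z).

Lemma ordered_space_basis :
  basis (@carrier X @` [set B | exists2 U, open U & B = induced_poset U]).
Proof.
split=> [_ [_ [U oU ->] <-] //|x A /=].
rewrite nbhsE => -[U [oU Ux] UA].
by exists U => //; split=> //; exists (induced_poset U) => //; exists U.
Qed.

Lemma ordered_space_directed (B B' : local_poset X) x :
  (exists2 U, open U & B = induced_poset U) ->
  (exists2 U, open U & B' = induced_poset U) ->
  carrier B x -> carrier B' x ->
  exists B'', [/\ exists2 U, open U & B'' = induced_poset U, carrier B'' x,
                  subposet B'' B & subposet B'' B'].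
Proof.
move=> [U oU ->] [V oV ->] /= Ux Vx; exists (induced_poset (U `&` V)).
by split=> //; [exists (U `&` V) => //; exact: openI | split=> // ? [] ..].
Qed.

Definition ordered_space_base : ordered_base X :=
  OrderedBase ordered_space_basis ordered_space_directed.

End OrderedSpace.

Section ProductOrder.
Variables (R : realType) (n : nat).
Implicit Types x y z : 'rV[R]_n.

Definition prod_le x y : Prop := forall i, x 0 i <= y 0 i.

Lemma prod_le_refl x : prod_le x x. Proof. by move=> i. Qed.

Lemma prod_le_antisym x y : prod_le x y -> prod_le y x -> x = y.
Proof. by move=> xy yx; apply/rowP => i; apply/le_anti; rewrite xy yx. Qed.

Lemma prod_le_trans x y z : prod_le x y -> prod_le y z -> prod_le x z.
Proof. by move=> xy yz i; exact: le_trans (xy i) (yz i). Qed.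

Definition Rn_base : ordered_base 'rV[R]_n :=
  ordered_space_base prod_le_refl prod_le_antisym prod_le_trans.

End ProductOrder.

(* The superscript of a face map is a boolean: false is -, true is +. In the
   identity, widen_ord _ i is i and lift ord0 j is j + 1, as directions of
   (k + 1)-cubes. *)
Record precubical := Precubical {
  cube_of :> nat -> Type;
  face : forall k, bool -> 'I_k -> cube_of k -> cube_of k.-1;
  faceK : forall k (e h : bool) (i j : 'I_k) (x : cube_of k.+1),
    (i <= j)%N ->
    face e j (face h (widen_ord (leqnSn k) i) x) =
    face h i (face e (lift ord0 j) x)
}.

Definition cube (P : precubical) := {k : nat & P k}.
Definition Cube (P : precubical) k (c : P k) : cube P := existT _ k c.

(* is_face E c d: c is obtained from d by applying (zero or more) face maps
   whose superscripts all belong to E. *)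
Inductive is_face (P : precubical) (E : pred bool) : cube P -> cube P -> Prop :=
| is_face_refl c : is_face E c c
| is_face_step c k (d : P k) (e : bool) (i : 'I_k) : E e ->
    is_face E c (Cube (face e i d)) -> is_face E c (Cube d).

Definition lower_face (P : precubical) : cube P -> cube P -> Prop :=
  is_face (pred1 false).
Definition upper_face (P : precubical) : cube P -> cube P -> Prop :=
  is_face (pred1 true).
Definition adjacent (P : precubical) (c d : cube P) : Prop :=
  is_face predT c d \/ is_face predT d c.

Definition is_minimum (P : precubical) (v : P 0%N) (c : cube P) : Prop :=
  lower_face (Cube v) c.
Definition is_maximum (P : precubical) (v : P 0%N) (c : cube P) : Prop :=
  upper_face (Cube v) c.

(* Direction i of act s x is direction s i of x. As (s * t)%g i = t (s i),
   act is a left action for the composition of MathComp. The last axiom covers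
   any permutation s0 and any i: s0 is lift_perm i (s0 i) s for a unique s. *)
Record sym_precubical := SymPrecubical {
  sym_base :> precubical;
  act : forall k, 'S_k -> sym_base k -> sym_base k;
  act1 : forall k (x : sym_base k), act 1%g x = x;
  actM : forall k (s t : 'S_k) (x : sym_base k),
    act (s * t)%g x = act s (act t x);
  face_act : forall k (e : bool) (i j : 'I_k.+1) (s : 'S_k)
      (x : sym_base k.+1),
    face e i (act (lift_perm i j s) x) = act s (face e j x)
}.

Definition sym_isomorphic (S T : sym_precubical) : Prop :=
  exists (f : forall k, S k -> T k) (g : forall k, T k -> S k),
  [/\ forall k, cancel (f k) (g k), forall k, cancel (g k) (f k),
      forall k e (i : 'I_k) (x : S k), f k.-1 (face e i x) = face e i (f k x)
    & forall k (s : 'S_k) (x : S k), f k (act s x) = act s (f k x)].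

(* Faces in distinct directions a and b commute; a' is a and b' is b, as
   directions of the face in the other direction. *)
Lemma face_comm (P : precubical) k (e h : bool) (a b : 'I_k.+1) (a' b' : 'I_k)
    (x : P k.+1) : lift a b' = b -> lift b a' = a ->
  face e b' (face h a x) = face h a' (face e b x).
Proof.
move=> /[dup] /(congr1 val) /= vab ab /[dup] /(congr1 val) /= vba ba.
have [ltab|leba] := ltnP a b.
  have eb : lift ord0 b' = b.
    by apply/val_inj; move: vab vba ltab; rewrite /= /bump; lia.
  have ea : widen_ord (leqnSn k) a' = a.
    by apply/val_inj; move: vab vba ltab; rewrite /= /bump; lia.
  by rewrite -ea -eb faceK //; move: vab vba ltab; rewrite /bump; lia.
have ea : lift ord0 a' = a.
  by apply/val_inj; move: vab vba leba; rewrite /= /bump; lia.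
have eb : widen_ord (leqnSn k) b' = b.
  by apply/val_inj; move: vab vba leba; rewrite /= /bump; lia.
by rewrite -ea -eb faceK //; move: vab vba leba; rewrite /bump; lia.
Qed.

(* The permutation induced by s on the directions other than i: it satisfies
   lift_perm i (s i) (lower_perm s i) = s. *)
Section LowerPerm.
Variables (k : nat) (s : 'S_k) (i : 'I_k).

Definition lower_perm_fun (j : 'I_k.-1) : 'I_k.-1 :=
  odflt j (unlift (s i) (s (lift i j))).

Lemma lower_perm_funK j : lift (s i) (lower_perm_fun j) = s (lift i j).
Proof.
rewrite /lower_perm_fun; have := neq_lift i j.
by rewrite -(can_eq (permK s)) => /unlift_some[] ? ? ->.
Qed.

Lemma lower_perm_inj : injective lower_perm_fun.
Proof.
move=> j1 j2 /(congr1 (lift (s i))); rewrite !lower_perm_funK.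
by move=> /perm_inj /lift_inj.
Qed.

Definition lower_perm : 'S_k.-1 := perm lower_perm_inj.

Lemma lift_lower_perm j : lift (s i) (lower_perm j) = s (lift i j).
Proof. by rewrite permE lower_perm_funK. Qed.

End LowerPerm.

Lemma lower_permK k (s : 'S_k.+1) (i : 'I_k.+1) :
  lift_perm i (s i) (lower_perm s i) = s.
Proof.
apply/permP => j; case: (unliftP i j) => [j' ->|->].
  by rewrite lift_perm_lift lift_lower_perm.
by rewrite lift_perm_id.
Qed.

Lemma lift_permK k (i j : 'I_k.+1) (s : 'S_k) :
  lower_perm (lift_perm i j s) i = s.
Proof.
apply/permP => l; apply: (@lift_inj _ j).
by rewrite -{1}(lift_perm_id i j s) lift_lower_perm lift_perm_lift.
Qed.

(* The free symmetric precubical set: (c, s) stands for act s c. *)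
Section FreeSym.
Variable P : precubical.

Definition free_face k (e : bool) (i : 'I_k) (x : P k * 'S_k) :
    P k.-1 * 'S_k.-1 :=
  (face e (x.2 i) x.1, lower_perm x.2 i).

Lemma free_faceK k (e h : bool) (i j : 'I_k) (x : P k.+1 * 'S_k.+1) :
  (i <= j)%N ->
  free_face e j (free_face h (widen_ord (leqnSn k) i) x) =
  free_face h i (free_face e (lift ord0 j) x).
Proof.
case: x => c s leij; rewrite /free_face /=.
set i' := widen_ord _ i; set j' := lift ord0 j.
have ij : lift i' j = j' by apply/val_inj; rewrite /= /bump leij.
have ji : lift j' i = i' by apply/val_inj; rewrite /= /bump /=; lia.
have sij : lift (s i') (lower_perm s i' j) = s j' by rewrite lift_lower_perm ij.
have sji : lift (s j') (lower_perm s j' i) = s i' by rewrite lift_lower_perm ji.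
congr pair; first exact: face_comm sij sji.
apply/permP => l.
apply: (@lift_inj _ (lower_perm s i' j)); apply: (@lift_inj _ (s i')).
rewrite !lift_lower_perm.
have liftC m (a b : 'I_m.+1) (a' b' : 'I_m) (l' : 'I_m.-1) :
    lift a b' = b -> lift b a' = a -> lift a (lift b' l') = lift b (lift a' l').
  move=> /(congr1 val) /= ab /(congr1 val) /= ba; apply/val_inj => /=.
  by move: ab ba; rewrite /bump; lia.
rewrite (liftC _ _ _ _ _ _ ij ji) (liftC _ _ _ _ _ _ sij sji).
by rewrite !lift_lower_perm.
Qed.

Definition free_precubical : precubical := Precubical free_faceK.

Definition free_act k (s : 'S_k) (x : P k * 'S_k) : P k * 'S_k :=
  (x.1, (s * x.2)%g).

Lemma free_act1 k (x : P k * 'S_k) : free_act 1%g x = x.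
Proof. by case: x => c s; rewrite /free_act mul1g. Qed.

Lemma free_actM k (s t : 'S_k) (x : P k * 'S_k) :
  free_act (s * t)%g x = free_act s (free_act t x).
Proof. by rewrite /free_act mulgA. Qed.

Lemma free_face_act k (e : bool) (i j : 'I_k.+1) (s : 'S_k)
    (x : P k.+1 * 'S_k.+1) :
  free_face e i (free_act (lift_perm i j s) x) = free_act s (free_face e j x).
Proof.
case: x => c t; rewrite /free_face /free_act /=.
rewrite permM lift_perm_id; congr pair.
by rewrite -{1}(lower_permK t j) lift_permM lift_permK.
Qed.

Definition free_sym : sym_precubical :=
  @SymPrecubical free_precubical free_act free_act1 free_actM free_face_act.

End FreeSym.

Definition precubical_isomorphic (P Q : precubical) : Prop :=
  sym_isomorphic (free_sym P) (free_sym Q).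

Section Tensor.
Variables P Q : precubical.

Record tensor_cube (m : nat) := TensorCube {
  tdim1 : nat;
  tdim2 : nat;
  tdimE : (tdim1 + tdim2)%N = m;
  tfst : P tdim1;
  tsnd : Q tdim2
}.

Lemma tensor_dim1 m a b : (a + b)%N = m -> 'I_a -> (a.-1 + b)%N = m.-1.
Proof. by move=> <-; case: a => [[]|a] //. Qed.

Lemma tensor_dim2 m a b : (a + b)%N = m -> 'I_b -> (a + b.-1)%N = m.-1.
Proof. by move=> <-; case: b => [[]|b] // _; rewrite addnS. Qed.

Definition tensor_face m (e : bool) (i : 'I_m) (x : tensor_cube m) :
    tensor_cube m.-1 :=
  let: TensorCube a b ab p q := x in
  match fintype.split (cast_ord (esym ab) i) with
  | inl i1 => TensorCube (tensor_dim1 ab i1) (face e i1 p) q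
  | inr i2 => TensorCube (tensor_dim2 ab i2) p (face e i2 q)
  end.

Lemma tensor_face1 m e (i : 'I_m) a b (ab : (a + b)%N = m) (p : P a) (q : Q b)
    (i1 : 'I_a) ab' : i = i1 :> nat ->
  tensor_face e i (TensorCube ab p q) =
  @TensorCube m.-1 a.-1 b ab' (face e i1 p) q.
Proof.
move=> ii1; have -> : i = cast_ord ab (lshift b i1) by apply/val_inj.
rewrite /= cast_ordK -/(unsplit (inl i1)) unsplitK.
by congr TensorCube; exact: Prop_irrelevance.
Qed.

Lemma tensor_face2 m e (i : 'I_m) a b (ab : (a + b)%N = m) (p : P a) (q : Q b)
    (i2 : 'I_b) ab' : i = (a + i2)%N :> nat ->
  tensor_face e i (TensorCube ab p q) =
  @TensorCube m.-1 a b.-1 ab' p (face e i2 q).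
Proof.
move=> ii2; have -> : i = cast_ord ab (rshift a i2) by apply/val_inj.
rewrite /= cast_ordK -/(unsplit (inr i2)) unsplitK.
by congr TensorCube; exact: Prop_irrelevance.
Qed.

Lemma tensor_faceK k (e h : bool) (i j : 'I_k) (x : tensor_cube k.+1) :
  (i <= j)%N ->
  tensor_face e j (tensor_face h (widen_ord (leqnSn k) i) x) =
  tensor_face h i (tensor_face e (lift ord0 j) x).
Proof.
case: x => a b ab p q leij; have [ia|ai] := ltnP i a.
  case: a ab p ia => [//|a] ab p ia; have ab' : (a + b)%N = k by case: ab.
  rewrite (tensor_face1 (m := k.+1) (i1 := Ordinal ia) _ _ _ _ ab') //.
  have [ja|aj] := ltnP j a.
    have ja1 : (j.+1 < a.+1)%N by [].
    have ia' : (i < a)%N := leq_ltn_trans leij ja.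
    rewrite (tensor_face1 (m := k) (i1 := Ordinal ja) _ _ _ _
      (tensor_dim1 ab' (Ordinal ja))) //.
    rewrite (tensor_face1 (m := k.+1) (i1 := Ordinal ja1) _ _ _ _ ab') //.
    rewrite (tensor_face1 (m := k) (i1 := Ordinal ia') _ _ _ _
      (tensor_dim1 ab' (Ordinal ja))) //=.
    congr TensorCube.
    have -> : Ordinal ia = widen_ord (leqnSn a) (Ordinal ia') by exact/val_inj.
    have -> : Ordinal ja1 = lift ord0 (Ordinal ja) by exact/val_inj.
    by rewrite faceK.
  have jb : (j - a < b)%N by have := ltn_ord j; lia.
  have ab2 : (a + b.-1)%N = k.-1 by lia.
  have ab3 : (a.+1 + b.-1)%N = k by lia.
  rewrite (tensor_face2 (m := k) (i2 := Ordinal jb) _ _ _ _ ab2);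
    last by rewrite /=; lia.
  rewrite (tensor_face2 (m := k.+1) (i2 := Ordinal jb) _ _ _ _ ab3); last first.
    by rewrite /= /bump /=; lia.
  by rewrite (tensor_face1 (m := k) (i1 := Ordinal ia) _ _ _ _ ab2).
have ib : (i - a < b.-1)%N by have := ltn_ord j; lia.
case: b ab q ib => [//|b] ab q ib; have ab' : (a + b)%N = k by lia.
have ib1 : (i - a < b.+1)%N by lia.
have jb : (j - a < b)%N by have := ltn_ord j; lia.
have jb1 : ((j - a).+1 < b.+1)%N by [].
have ab2 : (a + b.-1)%N = k.-1 by lia.
rewrite (tensor_face2 (m := k.+1) (i2 := Ordinal ib1) _ _ _ _ ab');
    last by rewrite /=; lia.
rewrite (tensor_face2 (m := k) (i2 := Ordinal jb) _ _ _ _ ab2);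
    last by rewrite /=; lia.
rewrite (tensor_face2 (m := k.+1) (i2 := Ordinal jb1) _ _ _ _ ab'); last first.
  by rewrite /= /bump /=; lia.
rewrite (tensor_face2 (m := k) (i2 := Ordinal ib) _ _ _ _ ab2);
    last by rewrite /=; lia.
congr TensorCube.
have -> : Ordinal ib1 = widen_ord (leqnSn b) (Ordinal ib) by exact/val_inj.
have -> : Ordinal jb1 = lift ord0 (Ordinal jb) by exact/val_inj.
by rewrite faceK //=; lia.
Qed.

Definition tensor : precubical := Precubical tensor_faceK.

End Tensor.

(* The unit of the tensor product: a single vertex. *)
Section Unit.

Definition point_cube (k : nat) : Type := if k is 0%N then unit else void.

Definition point_face k (e : bool) (i : 'I_k) :
    point_cube k -> point_cube k.-1 :=
  match k return point_cube k -> point_cube k.-1 with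
  | 0%N => fun x => x
  | _.+1 => fun x => match x with end
  end.

Lemma point_faceK k (e h : bool) (i j : 'I_k) (x : point_cube k.+1) :
  (i <= j)%N ->
  point_face e j (point_face h (widen_ord (leqnSn k) i) x) =
  point_face h i (point_face e (lift ord0 j) x).
Proof. by []. Qed.

Definition point : precubical := Precubical point_faceK.

End Unit.

(* The graph with one edge x -> x + 1 for each integer x. *)
Section Line.

Definition line_cube (k : nat) : Type :=
  match k with 0%N | 1%N => int | _ => void end.

Definition line_face k (e : bool) (i : 'I_k) : line_cube k -> line_cube k.-1 :=
  match k return line_cube k -> line_cube k.-1 with
  | 0%N => fun x => x
  | 1%N => fun x => if e then x + 1 else x
  | _.+2 => fun x => match x with end
  end.

Lemma line_faceK k (e h : bool) (i j : 'I_k) (x : line_cube k.+1) :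
  (i <= j)%N ->
  line_face e j (line_face h (widen_ord (leqnSn k) i) x) =
  line_face h i (line_face e (lift ord0 j) x).
Proof. by case: k i j x => [[]|]. Qed.

Definition line : precubical := Precubical line_faceK.

End Line.

Fixpoint tensor_power (P : precubical) (n : nat) : precubical :=
  if n is n'.+1 then tensor P (tensor_power P n') else point.

Section Realization.
Variables (R : realType) (P : precubical).

Definition open_cube {k} : set 'rV[R]_k := [set t | forall i, 0 < t 0 i < 1].
Definition closed_cube {k} : set 'rV[R]_k := [set t | forall i, 0 <= t 0 i <= 1].

Record realization := RealizationPoint {
  rpt : {k : nat & (P k * 'rV[R]_k)%type};
  rptP : open_cube (projT2 rpt).2
}.

HB.instance Definition _ := gen_eqMixin realization.
HB.instance Definition _ := gen_choiceMixin realization.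

(* p is the point with coordinates t of the open cube c *)
Definition at_coord k (c : P k) (t : 'rV[R]_k) (p : realization) : Prop :=
  rpt p = existT _ k (c, t).

Definition cell (c : cube P) : set realization :=
  [set p | exists t, at_coord (projT2 c) t p].

(* The characteristic map of a k-cube c, from [0,1]^k to |P|: a coordinate of
   t equal to 0 (resp. 1) selects the corresponding lower (resp. upper) face
   of c, and is dropped. It is only meaningful on closed_cube; outside of it,
   coordinates are clamped to [0,1]. *)
Fixpoint char_rpt k : P k -> 'rV[R]_k -> {k : nat & (P k * 'rV[R]_k)%type} :=
  match k with
  | 0%N => fun c t => existT _ 0%N (c, t)
  | k'.+1 => fun c t =>
      if [pick i | ~~ (0 < t 0 i < 1)] is Some i then
        @char_rpt k' (face (1 <= t 0 i) i c) (col' i t)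
      else existT _ k'.+1 (c, t)
  end.

Lemma char_rptP k (c : P k) (t : 'rV[R]_k) :
  open_cube (projT2 (char_rpt c t)).2.
Proof.
elim: k c t => [|k IH] c t /=; first by case.
by case: pickP => [i _|tP] //= i; exact/negbFE/tP.
Qed.

(* The choice made by pick in char_rpt is irrelevant. *)
Lemma char_rpt_face k (c : P k.+1) (t : 'rV[R]_k.+1) (i : 'I_k.+1) :
  ~~ (0 < t 0 i < 1) ->
  char_rpt c t = char_rpt (face (1 <= t 0 i) i c) (col' i t).
Proof.
elim: k c t i => [|k IH] c t i ti.
  rewrite [LHS]/=; case: pickP => [j _|/(_ i)]; last by rewrite ti.
  by rewrite (ord1 j) (ord1 i).
rewrite [LHS]/=; case: pickP => [j tj|/(_ i)]; last by rewrite ti.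
have [->//|neq_ji] := eqVneq j i.
have [i' ii'] : {i' | lift j i' = i}.
  by case: (unlift_some neq_ji) => i' ->; exists i'.
have [j' jj'] : {j' | lift i j' = j}.
  by rewrite eq_sym in neq_ji; case: (unlift_some neq_ji) => j' ->; exists j'.
have ti' : (col' j t) 0 i' = t 0 i by rewrite mxE ii'.
have tj' : (col' i t) 0 j' = t 0 j by rewrite mxE jj'.
apply: (etrans (IH _ _ i' _)); first by rewrite ti'.
apply/esym/(etrans (IH _ (col' i t) j' _)); first by rewrite tj'.
rewrite ti' tj'.
rewrite -(face_comm _ _ _ ii' jj'); congr (char_rpt _ _).
apply/rowP => l; rewrite !mxE; congr (t _ _).
apply/val_inj; move/(congr1 val): ii'; move/(congr1 val): jj' => /=.
by rewrite /bump; lia.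
Qed.

Definition char_map k (c : P k) (t : 'rV[R]_k) : realization :=
  RealizationPoint (@char_rptP k c t).

Definition realization_open (U : set realization) : Prop :=
  forall k (c : P k),
    open (char_map c @^-1` U : set (subspace (@closed_cube k))).

Lemma realization_openT : realization_open setT.
Proof. by move=> k c; rewrite preimage_setT; exact: openT. Qed.

Lemma realization_openI : setI_closed realization_open.
Proof.
by move=> U V oU oV k c; rewrite preimage_setI; exact: openI (oU k c) (oV k c).
Qed.

Lemma realization_open_bigU (I : Type) (f : I -> set realization) :
  (forall i, realization_open (f i)) -> realization_open (\bigcup_i f i).
Proof.
move=> of_ k c; rewrite preimage_bigcup.
by apply: bigcup_open => i _; exact: of_.
Qed.

HB.instance Definition _ := isOpenTopological.Build realization
  realization_openT realization_openI realization_open_bigU.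

(* The path g, parametrized by [0,1], is increasing whenever it stays in an
   open cube. *)
Definition increasing_on_cubes (g : R -> realization) : Prop :=
  forall k (c : P k) (a b : R), 0 <= a -> a <= b -> b <= 1 ->
    (forall s, a <= s <= b -> cell (Cube c) (g s)) ->
    forall t u, at_coord c t (g a) -> at_coord c u (g b) -> prod_le t u.

Definition dipath_in (B : set realization) (x y : realization) : Prop :=
  exists g : R -> realization,
    [/\ {within `[0, 1], continuous g}, g 0 = x, g 1 = y,
        forall s, 0 <= s <= 1 -> B (g s) & increasing_on_cubes g].

(* x and y are represented by points t and u of the closed cube c such that
   the segment ]t,u[ is directed and contained in the open cube. *)
Definition directed_segment (c : cube P) (x y : realization) : Prop :=
  exists t u : 'rV[R]_(projT1 c),
    [/\ closed_cube t /\ closed_cube u,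
        char_map (projT2 c) t = x /\ char_map (projT2 c) u = y,
        prod_le t u
      & forall s : R, 0 < s < 1 -> open_cube ((1 - s) *: t + s *: u)].

Definition is_vertex (v : P 0%N) (p : realization) : Prop := cell (Cube v) p.

(* In order_of_paths, dipath_in is a partial order on carrier B because it
   coincides there with ple B, which is one. The relations lower_face and
   upper_face being reflexive, the disjunct c' = c is redundant. *)
Record is_lo_realization (L : ordered_base realization) : Prop := {
  order_of_paths : forall B, base_elt L B ->
    forall x y, carrier B x -> carrier B y ->
      (ple B x y <-> dipath_in (carrier B) x y);
  order_of_segments : forall B, base_elt L B ->
    forall x y (c c' : cube P), carrier B x -> carrier B y ->
      cell c x -> cell c' y ->
      (lower_face c c' -> directed_segment c' x y -> ple B x y) /\
      (upper_face c c' -> directed_segment c' y x -> ple B y x);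
  nbhd_adjacent : forall (v : P 0%N) p B, is_vertex v p ->
    ordered_nbhd L p B ->
    forall c, carrier B `&` cell c !=set0 -> adjacent (Cube v) c;
  nbhd_above : forall (v : P 0%N) p B, is_vertex v p ->
    ordered_nbhd L p B ->
    forall c x y, is_minimum v c -> carrier B x -> cell c x ->
      carrier B y -> ple B x y ->
      exists2 c', cell c' y & lower_face c c' \/ c' = c;
  nbhd_below : forall (v : P 0%N) p B, is_vertex v p ->
    ordered_nbhd L p B ->
    forall c x y, is_maximum v c -> carrier B x -> cell c x ->
      carrier B y -> ple B y x ->
      exists2 c', cell c' y & upper_face c c' \/ c' = c
}.

End Realization.

(* Main.v *)
Require Import Defs.
From mathcomp Require Import all_boot all_order all_algebra all_fingroup.
From mathcomp Require Import all_classical all_reals all_analysis.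
From mathcomp Require Import zify lra.

Set Implicit Arguments.
Unset Strict Implicit.
Unset Printing Implicit Defensive.

Import Order.TTheory GRing.Theory Num.Theory.
Import numFieldNormedType.Exports.
Local Open Scope classical_set_scope.
Local Open Scope ring_scope.

(** Write [f] for the isomorphism from the realization of [P] to the space of
    dimension [n].  The cells of [P] are shown to be the cells of the
    subdivision of this space by a grid of hyperplanes, and a grid has the same
    combinatorics as the tensor power of the line.

    Boxes.  Inside small enough elements of the ordered base, [f] is an order
    embedding for the product order, and the order of an open cell is the order
    of its coordinates: near its minimum vertex for an arbitrary cube, because
    of the conditions on the neighborhoods of the vertices, and everywhere for a
    cube that is not a face of another one, because its open cell is open in the
    realization.  An order embedding of a [k]-dimensional box into dimension [n]
    requires [k <= n] ([order_dimension], [dim_le]), so every cube is a face of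
    a maximal one.  An order embedding with open image between boxes permutes
    the coordinates up to increasing changes of each of them
    ([local_coordinates]): the pairs of points that differ by one coordinate are
    those whose order interval is a chain.  The permutation is locally constant
    on the open cell of a maximal cube, hence constant, and the description
    extends to the closed cube by continuity and then to all of its faces
    ([coordinatewise_ex]).  In particular the closed cubes are embedded as boxes
    with sides parallel to the axes, and maximal cubes have dimension [n].

    Walls.  A direction [j] is free at a point [x] when it is one of the
    directions of the cell of [x].  A point near [x] lies in a cell that has the
    cell of [x] as a face, hence in a common maximal box [c] with [x]; whether
    [j] is free at a point of [c] only depends on whether its [j]-th coordinate
    lies strictly between those of the two [j]-th faces of [c].  Consequently,
    freeness of [j] is locally constant along the hyperplanes where the [j]-th
    coordinate is constant, hence it depends on this coordinate only
    ([free_hyperplane]): the points where [j] is not free form a union of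
    parallel hyperplanes, the walls.  The heights of the walls in direction [j]
    are discrete and unbounded on both sides, so they are enumerated in
    increasing order by the integers ([discrete_enum]).

    Labels.  The cell of [x] is determined by its free directions and by the
    indices of the last walls that are not above [x] ([cell_at_inj]); all
    combinations occur, and taking a face in direction [j] forgets [j] and, for
    an upper face, passes to the next wall ([cube_pos_face]).  The tensor power
    of the line has a labelling with the same properties, and such a labelling
    determines a precubical set up to isomorphism ([grid_labelling_iso]). *)

(** * Grid labellings of precubical sets *)

(** The cubes of the n-th tensor power of the line are the products of n
    factors, each of them an integer point [z] or an edge from [z] to [z + 1].
    Such a cube is recorded by the integers [pos c j] and by the directions
    [dir c i] of the factors that are edges; [label_inj] and [label_surj] say
    that every such product occurs exactly once.  Only the set of the
    directions is constrained, and not the order in which [dir c] lists them: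
    this is what makes the notion invariant under permutations of the
    directions of the cubes. *)
Record grid_labelling (P : precubical) (n : nat) := GridLabelling {
  dir : forall k, P k -> 'I_k -> 'I_n;
  pos : forall k, P k -> 'I_n -> int;
  dir_inj : forall k (c : P k), injective (dir c);
  dir_face : forall k e (i : 'I_k) (c : P k) l,
    dir (face e i c) l = dir c (lift i l);
  pos_face : forall k e (i : 'I_k) (c : P k) j,
    pos (face e i c) j = pos c j + (e && (j == dir c i))%:R;
  label_inj : forall k (c d : P k),
    codom (dir c) =i codom (dir d) -> pos c =1 pos d -> c = d;
  label_surj : forall k (a : 'I_k -> 'I_n) (z : 'I_n -> int), injective a ->
    exists c : P k, codom (dir c) =i codom a /\ pos c =1 z
}.

Lemma same_codom_perm k n (a b : 'I_k -> 'I_n) :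
  injective b -> codom a =i codom b -> exists s : 'S_k, forall i, a (s i) = b i.
Proof.
move=> b_inj ab.
have ba i : b i \in codom a by rewrite ab codom_f.
pose s i := iinv (ba i).
have sP i : a (s i) = b i by rewrite /s f_iinv.
have s_inj : injective s by move=> i j sij; apply: b_inj; rewrite -!sP sij.
by exists (perm s_inj) => i; rewrite permE sP.
Qed.

Section LabelFree.
Variables (P : precubical) (n : nat) (lab : grid_labelling P n).

Lemma free_label_inj k (x y : P k * 'S_k) :
  (forall i, dir lab x.1 (x.2 i) = dir lab y.1 (y.2 i)) ->
  pos lab x.1 =1 pos lab y.1 -> x = y.
Proof.
case: x y => [c s] [d t] /= dir_eq pos_eq.
have cd : c = d.
  apply: (label_inj (g := lab)) => // j; apply/codomP/codomP => -[i ->].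
    by exists (t (s^-1%g i)); rewrite -dir_eq permKV.
  by exists (s (t^-1%g i)); rewrite dir_eq permKV.
rewrite -cd in dir_eq *; congr pair; apply/permP => i.
exact/(dir_inj (g := lab))/dir_eq.
Qed.

Lemma free_label_surj k (a : 'I_k -> 'I_n) (z : 'I_n -> int) : injective a ->
  exists x : P k * 'S_k,
    (forall i, dir lab x.1 (x.2 i) = a i) /\ pos lab x.1 =1 z.
Proof.
move=> a_inj; have [c [ca cz]] := label_surj lab z a_inj.
by have [s sP] := same_codom_perm a_inj ca; exists (c, s).
Qed.

Lemma free_face_dir k e (i : 'I_k) (x : P k * 'S_k) l :
  dir lab (free_face e i x).1 ((free_face e i x).2 l) =
  dir lab x.1 (x.2 (lift i l)).
Proof. by rewrite /= dir_face lift_lower_perm. Qed.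

End LabelFree.

(** A labelling describes the whole free symmetric precubical set: a pair of a
    cube and a permutation is determined by the resulting injection of its
    directions into ['I_n] and by its position. *)
Lemma grid_labelling_iso (P Q : precubical) n :
  grid_labelling P n -> grid_labelling Q n -> precubical_isomorphic P Q.
Proof.
move=> lP lQ.
have exPQ P1 Q1 (l1 : grid_labelling P1 n) (l2 : grid_labelling Q1 n) :
    {f : forall k, P1 k * 'S_k -> Q1 k * 'S_k | forall k x,
      (forall i, dir l2 (f k x).1 ((f k x).2 i) = dir l1 x.1 (x.2 i)) /\
      pos l2 (f k x).1 =1 pos l1 x.1}.
  have ex k (x : P1 k * 'S_k) : exists y : Q1 k * 'S_k,
      (forall i, dir l2 y.1 (y.2 i) = dir l1 x.1 (x.2 i)) /\
      pos l2 y.1 =1 pos l1 x.1.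
    by apply: free_label_surj => i j /dir_inj /perm_inj.
  by exists (fun k x => projT1 (cid (ex k x))) => k x; case: cid.
have [f fP] := exPQ _ _ lP lQ; have [g gP] := exPQ _ _ lQ lP.
exists f, g; split=> [k x|k x|k e i x|k s x].
- apply: (free_label_inj (lab := lP)) => [i|j].
    by rewrite (gP k (f k x)).1 (fP k x).1.
  by rewrite (gP k (f k x)).2 (fP k x).2.
- apply: (free_label_inj (lab := lQ)) => [i|j].
    by rewrite (fP k (g k x)).1 (gP k x).1.
  by rewrite (fP k (g k x)).2 (gP k x).2.
- apply: (free_label_inj (lab := lQ)) => [l|j].
    by rewrite (fP _ _).1 !free_face_dir (fP k x).1.
  by rewrite (fP _ _).2 /= !pos_face (fP k x).2 (fP k x).1.
- apply: (free_label_inj (lab := lQ)) => [l|j].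
    by rewrite (fP _ _).1 /= !permM (fP k x).1.
  by rewrite (fP _ _).2 /= (fP k x).2.
Qed.

(** ** The labelling of the tensor powers of the line *)

Section TensorLabel.
Variables (Q : precubical) (n : nat) (lab : grid_labelling Q n).

Definition line_coord k : line k -> int :=
  match k return line k -> int with
  | 0%N | 1%N => id
  | _.+2 => fun x => match x with end
  end.

Definition tensor_dir k (x : tensor line Q k) (i : 'I_k) : 'I_n.+1 :=
  let: TensorCube a b ab p q := x in
  match fintype.split (cast_ord (esym ab) i) with
  | inl _ => ord0
  | inr i2 => lift ord0 (dir lab q i2)
  end.

Definition tensor_pos k (x : tensor line Q k) (j : 'I_n.+1) : int :=
  let: TensorCube a b ab p q := x in
  if unlift ord0 j is Some j' then pos lab q j' else line_coord p.

Lemma tensor_dir1 k a b (ab : (a + b)%N = k) (p : line a) (q : Q b) (i : 'I_k) :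
  (i < a)%N -> tensor_dir (TensorCube ab p q) i = ord0.
Proof. by move=> ia; rewrite /tensor_dir; case: splitP => //= j; lia. Qed.

Lemma tensor_dir2 k a b (ab : (a + b)%N = k) (p : line a) (q : Q b) (i : 'I_k)
    (i2 : 'I_b) : i = (a + i2)%N :> nat ->
  tensor_dir (TensorCube ab p q) i = lift ord0 (dir lab q i2).
Proof.
move=> ii2; rewrite /tensor_dir; case: splitP => /= j.
  by have := ltn_ord j; lia.
rewrite ii2 => /addnI ?; congr (lift _ (dir _ _ _)); exact/val_inj.
Qed.

Lemma tensor_dirP k a b (ab : (a + b)%N = k) (p : line a) (q : Q b) (i : 'I_k) :
  (exists2 i1 : 'I_a, i = i1 :> nat & tensor_dir (TensorCube ab p q) i = ord0)
  \/ (exists2 i2 : 'I_b, i = (a + i2)%N :> nat &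
       tensor_dir (TensorCube ab p q) i = lift ord0 (dir lab q i2)).
Proof.
have [ia|ai] := ltnP i a; [left|right].
  by exists (Ordinal ia) => //; exact: tensor_dir1.
have ib : (i - a < b)%N by have := ltn_ord i; lia.
have ii : i = (a + Ordinal ib)%N :> nat by rewrite /=; lia.
by exists (Ordinal ib) => //; exact: tensor_dir2.
Qed.

Lemma face_fst k e a b (ab : (a + b)%N = k) (p : line a) (q : Q b) (i : 'I_k)
    (i1 : 'I_a) : i = i1 :> nat ->
  face e i (TensorCube ab p q : tensor line Q k) =
  TensorCube (tensor_dim1 ab i1) (face e i1 p) q :> tensor line Q k.-1.
Proof. exact: tensor_face1. Qed.

Lemma face_snd k e a b (ab : (a + b)%N = k) (p : line a) (q : Q b) (i : 'I_k)
    (i2 : 'I_b) : i = (a + i2)%N :> nat ->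
  face e i (TensorCube ab p q : tensor line Q k) =
  TensorCube (tensor_dim2 ab i2) p (face e i2 q) :> tensor line Q k.-1.
Proof. exact: tensor_face2. Qed.

Lemma line_dim a : line a -> (a <= 1)%N. Proof. by case: a => [|[]]. Qed.

Lemma tensor_dir_inj k (x : tensor line Q k) : injective (tensor_dir x).
Proof.
case: x => a b ab p q i j; have a1 := line_dim p.
case: (tensor_dirP ab p q i) => -[i1 ii ->];
    case: (tensor_dirP ab p q j) => -[j1 jj ->].
- by move=> _; apply/val_inj => /=; have := ltn_ord i1; have := ltn_ord j1; lia.
- by move/eqP; rewrite (negPf (neq_lift _ _)).
- by move/esym/eqP; rewrite (negPf (neq_lift _ _)).
- by move=> /lift_inj/dir_inj ij; apply/val_inj; rewrite /= ii jj ij.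
Qed.

Lemma tensor_dir_face k e (i : 'I_k) (x : tensor line Q k) l :
  tensor_dir (face e i x) l = tensor_dir x (lift i l).
Proof.
case: x => a b ab p q; have a1 := line_dim p.
have vl : lift i l = bump i l :> nat by [].
have [ia|ai] := ltnP i a.
  rewrite (face_fst e (i1 := Ordinal ia) ab p q erefl).
  case: (tensor_dirP (tensor_dim1 ab (Ordinal ia)) (face e (Ordinal ia) p) q l).
    by move=> [i1 ll _]; have := ltn_ord i1; lia.
  move=> [i2 ll _]; rewrite (tensor_dir2 _ _ _ ll).
  by apply/esym/tensor_dir2; rewrite vl ll /bump; lia.
have ib : (i - a < b)%N by have := ltn_ord i; lia.
have ii : i = (a + Ordinal ib)%N :> nat by rewrite /=; lia.
rewrite (face_snd e (i2 := Ordinal ib) ab p q ii).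
case: (tensor_dirP (tensor_dim2 ab (Ordinal ib)) p (face e (Ordinal ib) q) l).
  by move=> [i1 ll ->]; rewrite tensor_dir1// vl /bump; have := ltn_ord i1; lia.
move=> [i2 ll ->]; rewrite dir_face; apply/esym/tensor_dir2.
by rewrite vl ll /= /bump; lia.
Qed.

Lemma tensor_pos_face k e (i : 'I_k) (x : tensor line Q k) j :
  tensor_pos (face e i x) j =
  tensor_pos x j + (e && (j == tensor_dir x i))%:R.
Proof.
case: x => a b ab p q; have a1 := line_dim p.
have [ia|ai] := ltnP i a.
  rewrite (face_fst e (i1 := Ordinal ia) ab p q erefl).
  rewrite tensor_dir1// /tensor_pos; case: (unliftP ord0 j) => [j' ->|->].
    by rewrite eq_sym (negPf (neq_lift _ _)) andbF addr0.
  rewrite eqxx andbT; case: a p a1 ab ia => [//|[|//]] p a1 ab ia /=.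
  by case: e; rewrite ?addr0.
have ib : (i - a < b)%N by have := ltn_ord i; lia.
have ii : i = (a + Ordinal ib)%N :> nat by rewrite /=; lia.
rewrite (face_snd e (i2 := Ordinal ib) ab p q ii).
rewrite (tensor_dir2 _ _ _ ii).
rewrite /tensor_pos; case: (unliftP ord0 j) => [j' ->|->].
  by rewrite pos_face (inj_eq lift_inj).
by rewrite (negPf (neq_lift _ _)) andbF addr0.
Qed.

Lemma tensor_dir_ord0 k a b (ab : (a + b)%N = k) (p : line a) (q : Q b) :
  (ord0 \in codom (tensor_dir (TensorCube ab p q))) = (0 < a)%N.
Proof.
apply/codomP/idP => [[i]|a0].
  case: (tensor_dirP ab p q i) => -[i1 ii ->]; first by have := ltn_ord i1; lia.
  by move/eqP; rewrite (negPf (neq_lift _ _)).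
have i0 : (0 < k)%N by lia.
by exists (Ordinal i0); rewrite tensor_dir1.
Qed.

Lemma tensor_dir_lift k a b (ab : (a + b)%N = k) (p : line a) (q : Q b) j :
  (lift ord0 j \in codom (tensor_dir (TensorCube ab p q))) =
  (j \in codom (dir lab q)).
Proof.
apply/codomP/codomP => -[i].
  case: (tensor_dirP ab p q i) => -[i1 ii ->].
    by move/esym/eqP; rewrite (negPf (neq_lift _ _)).
  by move/lift_inj; exists i1.
move=> ->; have ik : (a + i < k)%N by have := ltn_ord i; lia.
by exists (Ordinal ik); apply/esym/tensor_dir2.
Qed.

Lemma tensor_label_inj k (x y : tensor line Q k) :
  codom (tensor_dir x) =i codom (tensor_dir y) ->
  tensor_pos x =1 tensor_pos y -> x = y.
Proof.
case: x y => a b ab p q [a' b' ab' p' q'] xy pxy.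
have a1 := line_dim p; have a1' := line_dim p'.
have aa' : a = a'.
  by have := xy ord0; rewrite !tensor_dir_ord0; move: a1 a1'; lia.
have bb' : b = b' by lia.
move: p q ab xy pxy a1; rewrite aa' bb' => p q ab xy pxy _.
rewrite (Prop_irrelevance ab ab') in xy pxy *.
congr TensorCube; last first.
  apply: (label_inj (g := lab)) => j; first 
    by rewrite -(tensor_dir_lift ab' p) -(tensor_dir_lift ab' p') xy.
  by have := pxy (lift ord0 j); rewrite /tensor_pos liftK.
have := pxy ord0; rewrite /tensor_pos unlift_none.
by case: a' p p' a1' {aa' ab ab' xy pxy} => [|[|//]] p p' _.
Qed.

Lemma tensor_label_surj k (d : 'I_k -> 'I_n.+1) (z : 'I_n.+1 -> int) :
  injective d -> exists x : tensor line Q k,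
    codom (tensor_dir x) =i codom d /\ tensor_pos x =1 z.
Proof.
move=> d_inj; pose z' j := z (lift ord0 j).
have sub b (e : 'I_b -> 'I_k) : injective e ->
    (forall i, d (e i) != ord0) -> exists2 e' : 'I_b -> 'I_n, injective e' &
    forall i, lift ord0 (e' i) = d (e i).
  move=> e_inj e0.
  have ex i : {j | d (e i) = lift ord0 j}.
    by have := e0 i; rewrite eq_sym => /unlift_some[j -> _]; exists j.
  exists (fun i => projT1 (ex i)); last by move=> i; case: (ex i).
  move=> i1 i2 e12; apply/e_inj/d_inj.
  by case: (ex i1) (ex i2) e12 => j1 d1 [j2 d2] /= j12; rewrite d1 d2 j12.
case: (boolP (ord0 \in codom d)) => [/codomP[i0 di0]|d0].
  case: k d d_inj sub i0 di0 => [|k] d d_inj sub i0 di0;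
    first by case: i0 di0.
  have [|e' e'_inj de'] := sub k (lift i0) (@lift_inj _ _).
    by move=> i; rewrite di0 (inj_eq d_inj) eq_sym neq_lift.
  have [q [qe' qz]] := label_surj lab z' e'_inj.
  exists (@TensorCube line Q k.+1 1 k erefl (z ord0) q); split=> j.
    case: (unliftP ord0 j) => [j' ->|->].
      rewrite tensor_dir_lift qe'; apply/codomP/codomP => -[i].
        by move=> ->; exists (lift i0 i).
      case: (unliftP i0 i) => [i' ->|->].
        by rewrite -de' => /lift_inj ->; exists i'.
      by rewrite -di0 => /esym/eqP; rewrite (negPf (neq_lift _ _)).
    by rewrite tensor_dir_ord0 di0 codom_f.
  rewrite /tensor_pos; case: (unliftP ord0 j) => [j' ->|->] //; exact: qz.
have [//|i|e' e'_inj de'] := sub k id.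
  by apply: contra d0 => /eqP <-; exact: codom_f.
have [q [qe' qz]] := label_surj lab z' e'_inj.
exists (@TensorCube line Q k 0 k erefl (z ord0) q); split=> j.
  case: (unliftP ord0 j) => [j' ->|->].
    rewrite tensor_dir_lift qe'; apply/codomP/codomP => -[i].
      by move=> ->; exists i.
    by rewrite -de' => /lift_inj ->; exists i.
  by rewrite tensor_dir_ord0 (negPf d0).
rewrite /tensor_pos; case: (unliftP ord0 j) => [j' ->|->] //; exact: qz.
Qed.

Definition tensor_labelling : grid_labelling (tensor line Q) n.+1 :=
  GridLabelling tensor_dir_inj tensor_dir_face tensor_pos_face
    tensor_label_inj tensor_label_surj.

End TensorLabel.

Lemma point_labelling : grid_labelling Defs.point 0.
Proof.
have dir0 k : Defs.point k -> 'I_k -> 'I_0 by case: k => // _ [].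
exists dir0 (fun _ _ _ => 0).
- by case=> [|k] [] // [].
- by case=> [|k] e; [case|move=> ? []].
- by case=> [|k] e; [case|move=> ? []].
- by case=> [|k] [] // [].
- case=> [|k] a z _; last by case: (a ord0).
  by exists tt; split=> -[].
Qed.

Lemma tensor_power_line_labelling n : grid_labelling (tensor_power line n) n.
Proof.
elim: n => [|n IH]; first exact: point_labelling.
exact: tensor_labelling IH.
Qed.

(** * Boxes and segments *)

Section Boxes.
Variable R : realType.

Definition box k (t : 'rV[R]_k) (d : R) : set 'rV[R]_k :=
  [set u | forall i, `|u 0 i - t 0 i| < d].

Lemma box_center k (t : 'rV[R]_k) d : 0 < d -> box t d t.
Proof. by move=> d0 i; rewrite subrr normr0. Qed.

Lemma nbhs_box k (t : 'rV[R]_k) (U : set 'rV[R]_k) :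
  nbhs t U <-> exists2 d, 0 < d & box t d `<=` U.
Proof.
split=> [/nbhs_ballP[d /= d0 dU]|[d d0 dU]].
  exists d => // u tu; apply: dU; split=> // i j.
  by rewrite (ord1 i) /ball /= distrC; exact: tu.
apply/nbhs_ballP; exists d => //= u [_ tu]; apply: dU => i.
by rewrite distrC; exact: tu.
Qed.

Lemma finite_pos_lb (I : finType) (g : I -> R) : (forall i, 0 < g i) ->
  exists2 d, 0 < d & forall i, d <= g i.
Proof.
move=> g0; exists (\big[Num.min/1]_i g i); last by move=> i; exact: bigmin_le.
by apply/bigmin_gtP; split.
Qed.

(** Real induction: the set of the points [s] such that [Q 0 s] contains its
    least upper bound, by the hypothesis to the left of this bound, and the
    hypothesis to its right then forces the bound to be [1]. *)
Lemma interval_induction (Q : R -> R -> Prop) :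
  (forall a b c, Q a b -> Q b c -> Q a c) ->
  (forall s, 0 <= s <= 1 -> exists2 d, 0 < d & forall a b,
     0 <= a -> a <= s -> s <= b -> b <= 1 -> s - a < d -> b - s < d -> Q a b) ->
  Q 0 1.
Proof.
move=> Qtr Qloc.
pose S : set R := [set s | 0 <= s <= 1 /\ Q 0 s].
have S0 : S 0.
  split; first by rewrite lexx ler01.
  by have [|d d0] := Qloc 0; [rewrite lexx ler01|apply; lra].
have supS : has_sup S.
  by split; [exists 0 | exists 1 => s [] /andP[] ].
have m0 : 0 <= sup S by apply: ub_le_sup => //; exact: supS.2.
have m1 : sup S <= 1 by apply: ge_sup; [by exists 0|move=> s [] /andP[]].
have [|d d0 dQ] := Qloc (sup S); first by rewrite m0.
have [s [/andP[s0 s1] Qs] sd] := sup_adherent d0 supS.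
have sm : s <= sup S.
  by apply: ub_le_sup; [exact: supS.2|split=> //; rewrite s0].
have [m_eq1|m_neq1] := eqVneq (sup S) 1.
  by rewrite m_eq1 in dQ sm sd; apply: Qtr Qs _; apply: dQ => //; lra.
have mlt1 : sup S < 1 by rewrite lt_neqAle m_neq1.
pose b := Num.min 1 (sup S + d / 2).
have bP : sup S < b /\ b <= sup S + d / 2 /\ b <= 1.
  by rewrite /b; have [?|?] := leP 1 (sup S + d / 2); do !split; lra.
have Sb : S b.
  split; first by lra.
  by apply: Qtr Qs _; apply: dQ => //; lra.
by have := ub_le_sup supS.2 Sb; lra.
Qed.

Definition seg k (t u : 'rV[R]_k) (s : R) : 'rV[R]_k := (1 - s) *: t + s *: u.

Lemma segE k (t u : 'rV[R]_k) s i :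
  seg t u s 0 i = (1 - s) * t 0 i + s * u 0 i.
Proof. by rewrite !mxE. Qed.

Lemma seg0 k (t u : 'rV[R]_k) : seg t u 0 = t.
Proof. by apply/rowP => i; rewrite segE subr0 mul1r mul0r addr0. Qed.

Lemma seg1 k (t u : 'rV[R]_k) : seg t u 1 = u.
Proof. by apply/rowP => i; rewrite segE subrr mul0r mul1r add0r. Qed.

Lemma seg_mid k (t u : 'rV[R]_k) s i a b :
  0 <= s <= 1 -> a <= t 0 i <= b -> a <= u 0 i <= b -> a <= seg t u s 0 i <= b.
Proof. by rewrite segE => ? ? ?; nra. Qed.

Lemma seg_mid_lt k (t u : 'rV[R]_k) s i a b :
  0 <= s <= 1 -> a < t 0 i < b -> a < u 0 i < b -> a < seg t u s 0 i < b.
Proof.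
rewrite segE => /andP[s0 s1] /andP[ta tb] /andP[ua ub].
have conv x y : 0 < x -> 0 < y -> 0 < (1 - s) * x + s * y.
  move=> x0 y0; have [s2|s2] := ltP s 1; last first.
    have -> : s = 1 by lra.
    lra.
  by apply: ltr_wpDr; [rewrite mulr_ge0 // ltW | rewrite mulr_gt0 //; lra].
have := conv (t 0 i - a) (u 0 i - a); have := conv (b - t 0 i) (b - u 0 i).
by rewrite !subr_gt0 => /(_ tb ub) ? /(_ ta ua) ?; apply/andP; split; lra.
Qed.

Lemma seg_continuous k (t u : 'rV[R]_k) d : 0 < d ->
  exists2 e, 0 < e & forall s a, `|a - s| < e -> box (seg t u s) d (seg t u a).
Proof.
move=> d0.
have [i|e e0 elb] := @finite_pos_lb _ (fun i => d / (1 + `|u 0 i - t 0 i|)).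
  by rewrite divr_gt0// ltr_pwDl.
exists e => // s a sa i; rewrite !segE.
have -> : (1 - a) * t 0 i + a * u 0 i - ((1 - s) * t 0 i + s * u 0 i) =
  (a - s) * (u 0 i - t 0 i) by lra.
rewrite normrM; set l := `|u 0 i - _|; have l0 : 0 <= l by exact: normr_ge0.
have : `|a - s| * (1 + l) < d.
  by rewrite -ltr_pdivlMr; [exact: lt_le_trans sa (elb i)|lra].
by have := normr_ge0 (a - s); nra.
Qed.

(** This is how local properties become global below: boxes, open cubes and
    hyperplanes are convex, so that any two of their points are joined by a
    segment along which [interval_induction] applies. *)
Lemma segment_induction k (t u : 'rV[R]_k) (Q : 'rV[R]_k -> 'rV[R]_k -> Prop) :
  (forall x y z, Q x y -> Q y z -> Q x z) ->
  (forall s, 0 <= s <= 1 -> exists2 d, 0 < d & forall a b,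
     0 <= a -> a <= b -> b <= 1 ->
     box (seg t u s) d (seg t u a) -> box (seg t u s) d (seg t u b) ->
     Q (seg t u a) (seg t u b)) ->
  Q t u.
Proof.
move=> Qtr Qloc; rewrite -(seg0 t u) -{2}(seg1 t u).
pose Q' a b := Q (seg t u a) (seg t u b).
apply: (@interval_induction Q') => [a b c|s s01]; first exact: Qtr.
have [d d0 dQ] := Qloc s s01; have [e e0 eP] := seg_continuous t u d0.
exists e => // a b a0 sa sb b1 sea seb; apply: dQ => //; first by lra.
  by apply: eP; rewrite distrC ger0_norm; lra.
by apply: eP; rewrite ger0_norm; lra.
Qed.

End Boxes.

(** * The cells of a realization *)

Lemma Cube_inj (P : precubical) k (c d : P k) : Cube c = Cube d -> c = d.
Proof. exact: (Eqdep_dec.inj_pair2_eq_dec _ PeanoNat.Nat.eq_dec). Qed.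

Lemma is_face_trans (P : precubical) E (b c d : cube P) :
  is_face E b c -> is_face E c d -> is_face E b d.
Proof.
move=> bc cd; elim: cd bc => // c' k d' e i Ee _ IH bc.
exact: is_face_step Ee (IH bc).
Qed.

Lemma is_face_dim (P : precubical) E (c d : cube P) :
  is_face E c d -> c = d \/ (projT1 c < projT1 d)%N.
Proof.
elim=> [c'|c' k d' e i Ee _ IH]; [by left|right].
case: k d' i IH => [|k] d' i; first by case: i.
by case=> [-> //|/= /ltnW].
Qed.

Section Cells.
Variables (R : realType) (P : precubical).
Local Notation X := (realization R P).
Implicit Types p q : X.

Lemma rpt_inj p q : rpt p = rpt q -> p = q.
Proof.
case: p q => [x xo] [y yo] /= xy; rewrite -xy in yo *; congr RealizationPoint.
exact: Prop_irrelevance.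
Qed.

Definition cell_of p : cube P := Cube (projT2 (rpt p)).1.

Lemma cellP (c : cube P) p : cell c p <-> cell_of p = c.
Proof.
case: c => k c; split=> [[t]|]; rewrite /at_coord /cell_of /=.
  by move=> ->.
case rp: (rpt p) => [k' [c' t]] /=; rewrite /Cube => -[kk' cc'].
rewrite -kk' in c cc' *; exists t.
by rewrite /at_coord rp (Cube_inj cc').
Qed.

Lemma at_coord_inj k (c : P k) (t u : 'rV[R]_k) p :
  at_coord c t p -> at_coord c u p -> t = u.
Proof.
rewrite /at_coord => -> tu.
by have [] := Eqdep_dec.inj_pair2_eq_dec _ PeanoNat.Nat.eq_dec _ _ _ _ tu.
Qed.

Lemma open_closed k (t : 'rV[R]_k) : open_cube t -> closed_cube t.
Proof. by move=> to i; have := to i; lra. Qed.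

Lemma seg_closed k (t u : 'rV[R]_k) s :
  closed_cube t -> closed_cube u -> 0 <= s <= 1 -> closed_cube (seg t u s).
Proof. by move=> tc uc s01 i; apply: seg_mid. Qed.

Lemma seg_open k (t u : 'rV[R]_k) s :
  open_cube t -> open_cube u -> 0 <= s <= 1 -> open_cube (seg t u s).
Proof. by move=> tc uc s01 i; apply: seg_mid_lt. Qed.

Lemma const_open k (x : R) : 0 < x < 1 -> open_cube (const_mx x : 'rV_k).
Proof. by move=> x01 i; rewrite mxE. Qed.

Lemma const_closed k (x : R) : 0 <= x <= 1 -> closed_cube (const_mx x : 'rV_k).
Proof. by move=> x01 i; rewrite mxE. Qed.

Lemma closed_not_open k (t : 'rV[R]_k) : closed_cube t -> ~ open_cube t ->
  exists i (b : bool), t 0 i = b%:R.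
Proof.
move=> tc /existsNP[i /negP ti]; exists i; have := tc i.
by have [?|?] := leP (t 0 i) 0; [exists false|exists true] => //=; lra.
Qed.

Lemma char_map_open k (c : P k) (t : 'rV[R]_k) :
  open_cube t -> at_coord c t (char_map c t).
Proof.
rewrite /at_coord /=; case: k c t => [//|k] c t to /=.
by case: pickP => // i; rewrite to.
Qed.

Lemma cell_of_char k (c : P k) (t : 'rV[R]_k) :
  open_cube t -> cell_of (char_map c t) = Cube c.
Proof. by move=> /(char_map_open c); rewrite /cell_of => ->. Qed.

Lemma point_char p : exists k (c : P k) (t : 'rV[R]_k),
  open_cube t /\ p = char_map c t.
Proof.
case rp: (rpt p) => [k [c t]]; exists k, c, t.
have to : open_cube t by have := @rptP _ _ p; rewrite rp.
by split=> //; apply: rpt_inj; rewrite (char_map_open c to).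
Qed.

Lemma char_face k (c : P k.+1) (t : 'rV[R]_k.+1) i (b : bool) :
  t 0 i = b%:R -> char_map c t = char_map (face b i c : P k) (col' i t).
Proof.
move=> ti; apply: rpt_inj; rewrite /= -/(char_rpt c t).
rewrite (@char_rpt_face _ _ _ _ _ i) ti; last by case: b {ti} => /=; lra.
by congr (char_rpt (face _ _ _)); case: b {ti} => /=; rewrite ?lexx// ler10.
Qed.

Definition insert k (i : 'I_k.+1) (x : R) (t : 'rV[R]_k) : 'rV[R]_k.+1 :=
  \row_l if unlift i l is Some l' then t 0 l' else x.

Lemma insert_id k (i : 'I_k.+1) x (t : 'rV[R]_k) : insert i x t 0 i = x.
Proof. by rewrite mxE unlift_none. Qed.

Lemma insert_lift k (i : 'I_k.+1) x (t : 'rV[R]_k) l :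
  insert i x t 0 (lift i l) = t 0 l.
Proof. by rewrite mxE liftK. Qed.

Lemma col'_insert k (i : 'I_k.+1) x (t : 'rV[R]_k) : col' i (insert i x t) = t.
Proof. by apply/rowP => l; rewrite mxE insert_lift. Qed.

Lemma insert_closed k (i : 'I_k.+1) (b : bool) (t : 'rV[R]_k) :
  closed_cube t -> closed_cube (insert i b%:R t).
Proof.
move=> tc l; case: (unliftP i l) => [l' ->|->]; first by rewrite insert_lift.
by rewrite insert_id; case: b => /=; rewrite ?lexx ?ler01.
Qed.

Lemma char_insert k (c : P k.+1) (i : 'I_k.+1) (b : bool) (t : 'rV[R]_k) :
  char_map c (insert i b%:R t) = char_map (face b i c : P k) t.
Proof. by rewrite (@char_face _ _ _ i b) ?insert_id ?col'_insert. Qed.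

Lemma col'_closed k (i : 'I_k.+1) (t : 'rV[R]_k.+1) :
  closed_cube t -> closed_cube (col' i t).
Proof. by move=> tc l; rewrite mxE. Qed.

Lemma cell_face k (c : P k) (t : 'rV[R]_k) : closed_cube t ->
  is_face predT (cell_of (char_map c t)) (Cube c).
Proof.
elim: k c t => [|k IH] c t tc.
  by rewrite cell_of_char; [exact: is_face_refl|case].
have [to|/(closed_not_open tc)[i [b tib]]] := pselect (open_cube t).
  by rewrite cell_of_char //; exact: is_face_refl.
rewrite (char_face c tib); apply: (@is_face_step _ _ _ _ _ b i) => //.
exact/IH/col'_closed.
Qed.

Lemma cell_dim_open k (c : P k) (t : 'rV[R]_k) : closed_cube t ->
  projT1 (cell_of (char_map c t)) = k -> open_cube t.
Proof.
case: k c t => [|k] c t tc; first by move=> _ [].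
move=> dimk; apply: contrapT => /(closed_not_open tc)[i [b tib]].
move: dimk; rewrite (char_face c tib).
have [->|] := is_face_dim (cell_face (face b i c : P k) (col'_closed i tc)).
  by rewrite /=; lia.
by rewrite /=; lia.
Qed.

(** A point [u] close enough to [t] satisfies the hypothesis: it may only have
    left some of the faces that contain [t]. *)
Lemma cell_face_of_char k (c : P k) (t u : 'rV[R]_k) :
  closed_cube t -> closed_cube u ->
  (forall i (b : bool), u 0 i = b%:R -> t 0 i = b%:R) ->
  is_face predT (cell_of (char_map c t)) (cell_of (char_map c u)).
Proof.
elim: k c t u => [|k IH] c t u tc uc ut.
  by rewrite !cell_of_char; [exact: is_face_refl|case|case].
have [uo|/(closed_not_open uc)[i [b uib]]] := pselect (open_cube u).
  by rewrite (cell_of_char c uo); exact: cell_face.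
rewrite (char_face c uib) (char_face c (ut _ _ uib)).
by apply: IH => [||l b']; [exact: col'_closed..|rewrite !mxE; exact: ut].
Qed.

Lemma face_char_map E (c d : cube P) (t : 'rV[R]_(projT1 c)) :
  is_face E c d -> closed_cube t ->
  exists2 u, closed_cube u & char_map (projT2 d) u = char_map (projT2 c) t.
Proof.
move=> cd tc; elim: cd t tc => [c'|c' k d' e i _ _ IH] t tc; first by exists t.
have [u uc <-] := IH t tc; case: k d' i {IH} u uc => [|k] d' i u uc.
  by case: i u uc.
by exists (insert i e%:R u); [exact: insert_closed|rewrite char_insert].
Qed.

Lemma closed_cell k (c : P k) p : is_face predT (cell_of p) (Cube c) ->
  exists2 t, closed_cube t & char_map c t = p.
Proof.
have [k' [d [u [uo ->]]]] := point_char p.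
rewrite cell_of_char // => /face_char_map/(_ (open_closed uo)); exact.
Qed.

(** ** The topology *)

Lemma realization_openP (U : set X) : open U <->
  forall k (c : P k) t, closed_cube t -> U (char_map c t) ->
    exists2 d : R, 0 < d &
      forall u, closed_cube u -> box t d u -> U (char_map c u).
Proof.
split=> [oU k c t tc Ut|H].
  have := oU k c; rewrite openE => /(_ t Ut); rewrite /interior.
  rewrite /interior /= /nbhs /= -(nbhs_subspace_in tc) => /nbhs_box[d d0 dU].
  by exists d => // u uc tu; exact: dU tu uc.
move=> k c; rewrite openE.
suff nbhsU (t : 'rV[R]_k) : U (char_map c t) ->
    nbhs_subspace (A := @closed_cube R k) t (char_map c @^-1` U).
  exact: nbhsU.
move=> Ut; have [tc|tc] := pselect (closed_cube t); last first.
  by rewrite -(nbhs_subspace_out tc) => _ ->.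
rewrite -(nbhs_subspace_in tc); have [d d0 dU] := H k c t tc Ut.
by apply/nbhs_box; exists d => // u tu uc; exact: dU.
Qed.

Lemma open_star (c : cube P) : open [set p | is_face predT c (cell_of p)].
Proof.
apply/realization_openP => k d t tc /= cdt.
have [i|e e0 elb] := @finite_pos_lb R 'I_k
  (fun i => if t 0 i == 0 then 1 else if t 0 i == 1 then 1 else
     Num.min (t 0 i) (1 - t 0 i)).
  have := tc i; case: eqVneq => // t0; case: eqVneq => // t1 ti.
  by rewrite lt_min; lra.
exists e => // u uc tu; apply: is_face_trans cdt _.
apply: cell_face_of_char => // i b uib.
have := elb i; have := tu i; have := tc i; rewrite ltr_norml uib.
case: eqVneq => [->|t0]; first by case: b {uib} => //=; lra.
case: eqVneq => [->|t1]; first by case: b {uib} => //=; lra.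
by rewrite le_min; case: b {uib} => /=; lra.
Qed.

Definition maximal k (c : P k) :=
  forall d, is_face predT (Cube c) d -> Cube c = d.

(** Around a point of the open cell of a maximal cube [c], there are no other
    cells than that of [c]. *)
Lemma open_maximal k (c : P k) (N : set 'rV[R]_k) : maximal c ->
  N `<=` @open_cube R k -> open N -> open (char_map c @` N).
Proof.
move=> cmax No oN; apply/realization_openP => k' d t tc [u Nu].
move=> udt; have := cell_face d tc; rewrite -udt (cell_of_char c (No _ Nu)).
move/cmax => cd; have kk' : k = k' by case: cd.
case: _ / kk' d t tc udt cd => d t tc udt /Cube_inj cd; rewrite -cd in udt *.
have to : open_cube t.
  apply: (cell_dim_open (c := c)) => //.
  by rewrite -udt cell_of_char //; exact: No.
have tu : t = u.
  apply: (at_coord_inj (char_map_open c to)); rewrite -udt.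
  exact/char_map_open/No.
have : nbhs t N by rewrite tu; exact: open_nbhs_nbhs.
by move=> /nbhs_box[e e0 eN]; exists e => // v vc tv; exists v => //; exact: eN.
Qed.

End Cells.

(** * Order embeddings between boxes are coordinatewise *)

Section LocalCoordinates.
Variable R : realType.

Definition upd k (y : 'rV[R]_k) (i : 'I_k) (x : R) : 'rV[R]_k :=
  \row_l if l == i then x else y 0 l.

Lemma upd_id k (y : 'rV[R]_k) i x : upd y i x 0 i = x.
Proof. by rewrite mxE eqxx. Qed.

Lemma upd_neq k (y : 'rV[R]_k) i x l : l != i -> upd y i x 0 l = y 0 l.
Proof. by move=> li; rewrite mxE (negPf li). Qed.

Lemma upd_le k (y z : 'rV[R]_k) i x :
  (forall l, l != i -> y 0 l <= z 0 l) -> x <= z 0 i -> prod_le (upd y i x) z.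
Proof.
by move=> yz xz l; have [->|li] := eqVneq l i; rewrite ?upd_id ?upd_neq ?yz.
Qed.

Lemma le_upd k (y z : 'rV[R]_k) i x :
  (forall l, l != i -> z 0 l <= y 0 l) -> z 0 i <= x -> prod_le z (upd y i x).
Proof.
by move=> yz xz l; have [->|li] := eqVneq l i; rewrite ?upd_id ?upd_neq ?yz.
Qed.

Lemma upd_upd k (y : 'rV[R]_k) i x x' : upd (upd y i x') i x = upd y i x.
Proof.
by apply/rowP => l; have [->|li] := eqVneq l i; rewrite ?upd_id ?upd_neq.
Qed.

Lemma upd_same k (y : 'rV[R]_k) i : upd y i (y 0 i) = y.
Proof.
by apply/rowP => l; have [->|li] := eqVneq l i; rewrite ?upd_id ?upd_neq.
Qed.

Lemma prod_lt_ex k (y z : 'rV[R]_k) : prod_le y z -> y <> z ->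
  exists i, y 0 i < z 0 i.
Proof.
move=> yz yNz; apply: contrapT => /forallNP nlt; apply: yNz; apply/rowP => i.
by apply/le_anti; rewrite yz /= leNgt; exact/negP/nlt.
Qed.

Lemma box_upd k (p y : 'rV[R]_k) d i x :
  box p d y -> `|x - p 0 i| < d -> box p d (upd y i x).
Proof.
by move=> py px l; have [->|li] := eqVneq l i; rewrite ?upd_id ?upd_neq.
Qed.

Lemma box_le_upd k (p y w : 'rV[R]_k) d i :
  box p d y -> box p d w -> box p d (upd y i (w 0 i)).
Proof. by move=> py pw; apply: box_upd. Qed.

Variables (m n : nat) (phi : 'rV[R]_m -> 'rV[R]_n) (p : 'rV[R]_m) (d : R).
Local Notation N := (box p d).
Hypothesis d_gt0 : 0 < d.
Hypothesis phi_emb : forall y z, N y -> N z ->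
  (prod_le (phi y) (phi z) <-> prod_le y z).
Hypothesis phi_open : forall y, N y ->
  exists2 e : R, 0 < e &
    forall w, box (phi y) e w -> exists2 z, N z & phi z = w.

Lemma phi_inj y z : N y -> N z -> phi y = phi z -> y = z.
Proof.
move=> Ny Nz yz; apply: prod_le_antisym; apply/phi_emb => //; rewrite yz;
exact: prod_le_refl.
Qed.

Lemma phi_mono y z : N y -> N z -> prod_le y z -> prod_le (phi y) (phi z).
Proof. by move=> Ny Nz /phi_emb; exact. Qed.

Lemma bump_ex y j h : N y -> 0 < h -> exists w x, [/\ N w,
  phi w = upd (phi y) j x, phi y 0 j < x & x <= phi y 0 j + h].
Proof.
move=> Ny h0; have [e e0 eP] := phi_open Ny.
pose h' := Num.min h (e / 2).
have [h'0 h'h h'e] : [/\ 0 < h', h' <= h & h' < e].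
  by rewrite /h'; have [?|?] := leP h (e / 2); split; lra.
have [|w Nw wE] := eP (upd (phi y) j (phi y 0 j + h')).
  by apply: box_upd; [exact: box_center|rewrite addrAC subrr add0r gtr0_norm].
by exists w, (phi y 0 j + h'); split=> //; lra.
Qed.

(** The points of the image of [phi] between [phi y] and [phi w] form a chain,
    whereas raising one or the other of two coordinates of [y] would give
    incomparable points. *)
Lemma bump_single y w j x : N y -> N w -> phi w = upd (phi y) j x ->
  phi y 0 j < x -> exists2 i, y 0 i < w 0 i & w = upd y i (w 0 i).
Proof.
move=> Ny Nw wE jx.
have yw : prod_le y w.
  by apply/phi_emb; rewrite // wE; apply: le_upd => //; exact: ltW.
have [|i yi] := prod_lt_ex yw.
  by move=> eyw; move: jx; rewrite -eyw in wE; rewrite wE upd_id ltxx.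
exists i => //; apply/rowP => l.
have [->|li] := eqVneq l i; first by rewrite upd_id.
rewrite upd_neq //; apply/le_anti; rewrite yw andbT leNgt; apply/negP => yl.
have Na := box_le_upd i Ny Nw; have Nb := box_le_upd l Ny Nw.
have btw k : prod_le (phi (upd y k (w 0 k))) (phi w) /\
             prod_le (phi y) (phi (upd y k (w 0 k))).
  have Nk := box_le_upd k Ny Nw.
  by split; apply: phi_mono => //; [apply: upd_le|apply: le_upd].
have other k j' : j' != j -> phi (upd y k (w 0 k)) 0 j' = phi y 0 j'.
  move=> jj; apply/le_anti; rewrite (btw k).2 andbT.
  by have := (btw k).1 j'; rewrite wE upd_neq.
have chain k k' : prod_le (upd y k (w 0 k)) (upd y k' (w 0 k')) ->
    y 0 k < w 0 k -> k = k'.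
  move=> /(_ k); rewrite upd_id; have [//|kk] := eqVneq k k'.
  by rewrite upd_neq // => le_wy; rewrite ltNge le_wy.
have [ab|ba] := leP (phi (upd y i (w 0 i)) 0 j) (phi (upd y l (w 0 l)) 0 j).
  move/eqP: li; apply; apply/esym/chain => //; apply/phi_emb => // j'.
  by have [->|jj] := eqVneq j' j; rewrite ?ab // !other.
move/eqP: li; apply; apply/chain => //; apply/phi_emb => // j'.
by have [->|jj] := eqVneq j' j; [exact: ltW|rewrite !other].
Qed.

(** Conversely, if [phi] raised two coordinates of [phi y] at once, then
    raising each of them alone by a small amount, which is possible as the image
    is open, would give incomparable points in the image of a chain. *)
Lemma single_dir y i x : N y -> N (upd y i x) -> y 0 i < x ->
  exists2 j, phi y 0 j < phi (upd y i x) 0 j &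
    forall j', j' != j -> phi (upd y i x) 0 j' = phi y 0 j'.
Proof.
move=> Ny Ny' yx; set y' := upd y i x in Ny' *.
have yy' : prod_le y y' by apply: le_upd => //; exact: ltW.
have le_phi := phi_mono Ny Ny' yy'.
have [|j jlt] := prod_lt_ex le_phi.
  by move=> /(phi_inj Ny Ny') eyy; move: yx; rewrite eyy upd_id ltxx.
exists j => // j' jj'; apply/le_anti; rewrite le_phi andbT leNgt.
apply/negP => j'lt.
have btw k : phi y 0 k < phi y' 0 k -> exists w a, [/\ N w,
    phi w = upd (phi y) k a, phi y 0 k < a & w = upd y i (w 0 i)].
  rewrite -subr_gt0 => klt; have [w [a [Nw wE ka ak]]] := bump_ex k Ny klt.
  exists w, a; split=> //.
  have yw : prod_le y w.
    by apply/phi_emb; rewrite // wE; apply: le_upd => //; exact: ltW.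
  have wy' : prod_le w y'.
    apply/phi_emb => //; rewrite wE; apply: upd_le; last by lra.
    by move=> l _; exact: le_phi.
  apply/rowP => l; have [->|li] := eqVneq l i; first by rewrite upd_id.
  by rewrite upd_neq //; apply/le_anti; rewrite yw andbT -(upd_neq y x li).
have [w [a [Nw wE ja wi]]] := btw j jlt.
have [w' [a' [Nw' wE' ja' wi']]] := btw j' j'lt.
have [ww|ww] := leP (w 0 i) (w' 0 i).
  have /(phi_mono Nw Nw')/(_ j) : prod_le w w'.
    rewrite wi wi'; apply: upd_le; rewrite ?upd_id // => l li.
    by rewrite upd_neq.
  by rewrite wE wE' upd_id upd_neq 1?eq_sym // leNgt ja.
have /(phi_mono Nw' Nw)/(_ j') : prod_le w' w.
  rewrite wi wi'; apply: upd_le; rewrite ?upd_id; last exact: ltW.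
  by move=> l li; rewrite upd_neq.
by rewrite wE wE' upd_id upd_neq // leNgt ja'.
Qed.

(** If moving up in direction [i] from [y] and from [z], which is above [y],
    raised distinct coordinates [j] and [j'] of the image, then [phi z] would
    already be above [phi (upd y i x)]. *)
Lemma dir_above y z i x j j' : N y -> N z -> N (upd y i x) -> N (upd z i x) ->
  prod_le y z -> y 0 i = z 0 i -> y 0 i < x ->
  phi y 0 j < phi (upd y i x) 0 j -> phi z 0 j' < phi (upd z i x) 0 j' ->
  j = j'.
Proof.
move=> Ny Nz Ny' Nz' yz yzi yx yj zj'.
have [j1 _ y1] := single_dir Ny Ny' yx.
have jj1 : j = j1.
  by apply: contraTeq yj => /y1 ->; rewrite ltxx.
have zx : z 0 i < x by rewrite -yzi.
have [j2 _ z2] := single_dir Nz Nz' zx.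
have jj2 : j' = j2.
  by apply: contraTeq zj' => /z2 ->; rewrite ltxx.
have [//|jj'] := eqVneq j j'.
suff /(_ i) : prod_le (upd y i x) z by rewrite upd_id leNgt zx.
apply/phi_emb => // l; have [->|lj] := eqVneq l j; last first.
  by rewrite y1 -?jj1 //; exact: phi_mono.
rewrite -(z2 j) -?jj2 //; apply: phi_mono => //.
by apply: upd_le; rewrite ?upd_id // => k ki; rewrite upd_neq.
Qed.

Lemma dir_hull y i a b a' b' j : N y -> N (upd y i a') -> N (upd y i b') ->
  N (upd y i a) -> N (upd y i b) -> a' <= a -> b <= b' ->
  phi (upd y i a) 0 j < phi (upd y i b) 0 j ->
  phi (upd y i a') 0 j < phi (upd y i b') 0 j.
Proof.
move=> Ny Na' Nb' Na Nb aa bb ab.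
have le_upd2 x x' : x <= x' -> prod_le (upd y i x) (upd y i x').
  by move=> xx; apply: upd_le; rewrite ?upd_id // => l li; rewrite upd_neq.
by apply: le_lt_trans (lt_le_trans ab _); apply: phi_mono => //; exact: le_upd2.
Qed.

(** To compare two moves in direction [i], both of them are extended to a
    common range, by [dir_hull], and then compared with the parallel move from
    the meet of their origins, by [dir_above]. *)
Lemma dir_unique y z i x x' j j' : N y -> N z ->
  N (upd y i x) -> N (upd z i x') -> y 0 i < x -> z 0 i < x' ->
  phi y 0 j < phi (upd y i x) 0 j -> phi z 0 j' < phi (upd z i x') 0 j' ->
  j = j'.
Proof.
move=> Ny Nz Ny' Nz' yx zx yj zj.
pose a := Num.min (y 0 i) (z 0 i); pose b := Num.max x x'.
have [ay az xb x'b] : [/\ a <= y 0 i, a <= z 0 i, x <= b & x' <= b].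
  by rewrite /a /b; split; rewrite ?ge_min ?le_max lexx ?orbT.
have ab : a < b by lra.
have pa : `|a - p 0 i| < d by rewrite /a; have [_|_] := leP (y 0 i) (z 0 i).
have pb : `|b - p 0 i| < d.
  have := Ny' i; have := Nz' i; rewrite !upd_id /b.
  by have [?|?] := leP x x'.
have Na u : N u -> N (upd u i a) by move=> Nu; exact: box_upd.
have Nb u : N u -> N (upd u i b) by move=> Nu; exact: box_upd.
pose w := \row_l Num.min (upd y i a 0 l) (upd z i a 0 l).
have Nw : N w.
  move=> l; rewrite mxE; have := Na y Ny l; have := Na z Nz l.
  by have [?|?] := leP (upd y i a 0 l) (upd z i a 0 l).
have wi : w 0 i = a by rewrite mxE !upd_id minxx.
have wx : w 0 i < b by rewrite wi.
have [jw wjw _] := single_dir Nw (Nb w Nw) wx.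
have aux u k x1 : N u -> N (upd u i x1) -> prod_le w (upd u i a) ->
    a <= u 0 i -> x1 <= b -> phi u 0 k < phi (upd u i x1) 0 k -> jw = k.
  move=> Nu Nu' wu au x1b uk.
  have := @dir_above w (upd u i a) i b jw k Nw (Na u Nu) (Nb w Nw) _ wu.
  rewrite upd_upd upd_id; apply => //; first exact: Nb.
  rewrite -{1}(upd_same u i) in uk.
  apply: (dir_hull Nu (Na u Nu) (Nb u Nu) _ Nu' au x1b uk).
  by rewrite upd_same.
rewrite -(aux y j x Ny Ny' _ ay xb yj); last first.
  by move=> l; rewrite mxE ge_min lexx.
by apply: (aux z j' x' Nz Nz' _ az x'b zj) => l; rewrite mxE ge_min lexx orbT.
Qed.

Lemma dir_ex : exists J : 'I_m -> 'I_n, forall i y x,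
  N y -> N (upd y i x) -> y 0 i < x ->
  phi y 0 (J i) < phi (upd y i x) 0 (J i) /\
  forall j, j != J i -> phi (upd y i x) 0 j = phi y 0 j.
Proof.
have Np : N p by exact: box_center.
have ppx i : p 0 i < p 0 i + d / 2 by rewrite ltrDl divr_gt0.
have Np' i : N (upd p i (p 0 i + d / 2)).
  by apply: box_upd => //; rewrite ltr_norml; have := d_gt0; lra.
have ex i : exists j, phi p 0 j < phi (upd p i (p 0 i + d / 2)) 0 j.
  by have [j ? _] := single_dir Np (Np' i) (ppx i); exists j.
pose J i := projT1 (cid (ex i)); exists J => i y x Ny Ny' yx.
have [j yj yj'] := single_dir Ny Ny' yx.
suff -> : J i = j by [].
rewrite /J; case: cid => j1 /= pj1.
exact: (dir_unique Np Ny (Np' i) Ny' (ppx i) yx pj1 yj).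
Qed.

(** The map [J] of [dir_ex] only controls moves in one direction.  If [y] and
    [z], with [y] below [z], have the same [i]-th coordinate and [phi z] had a
    larger [J i]-th coordinate than [phi y], then one could raise this
    coordinate of [phi y] a little while staying below [phi z]; but this raises
    the [i]-th coordinate of [y], contradicting that the raised point is below
    [z]. *)
Lemma local_coordinates : exists J : 'I_m -> 'I_n,
  [/\ injective J, forall j, exists i, J i = j
    & forall y z, N y -> N z -> forall i,
        (y 0 i <= z 0 i) = (phi y 0 (J i) <= phi z 0 (J i))].
Proof.
have [J JP] := dir_ex; exists J.
have Np : N p by exact: box_center.
have ppx i : p 0 i < p 0 i + d / 2 by rewrite ltrDl divr_gt0.
have Np' i : N (upd p i (p 0 i + d / 2)).
  by apply: box_upd => //; rewrite ltr_norml; have := d_gt0; lra.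
have Jinj : injective J.
  move=> i i' Jii'; apply/eqP; apply: contraPT Jii' => ii' Jii'.
  have [_ iP] := JP i p _ Np (Np' i) (ppx i).
  have [_ iP'] := JP i' p _ Np (Np' i') (ppx i').
  pose q k := upd p k (p 0 k + d / 2).
  have incomp k k' : k != k' -> ~ prod_le (phi (q k)) (phi (q k')).
    move=> kk' /(phi_emb (Np' k) (Np' k'))/(_ k).
    by rewrite upd_id upd_neq // leNgt ppx.
  have [le|le] := leP (phi (q i) 0 (J i)) (phi (q i') 0 (J i)).
    apply: (incomp _ _ ii') => j.
    have [->|jJ] := eqVneq j (J i); first exact: le.
    by rewrite iP // iP' // -Jii'.
  rewrite eq_sym in ii'.
  apply: (incomp _ _ ii') => j.
  have [->|jJ] := eqVneq j (J i); first exact: ltW.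
  by rewrite iP // iP' // -Jii'.
have eqJ_le y z i : N y -> N z -> prod_le y z -> y 0 i = z 0 i ->
    phi y 0 (J i) = phi z 0 (J i).
  move=> Ny Nz yz yzi; apply/le_anti; rewrite (phi_mono Ny Nz yz) leNgt /=.
  apply/negP; rewrite -subr_gt0 => lt.
  have [w [x [Nw wE yJx xle]]] := bump_ex (J i) Ny lt.
  have [i' yi' wi'] := bump_single Ny Nw wE yJx.
  have ii' : i' = i.
    apply: Jinj.
    have [|jlt _] := JP i' y (w 0 i') Ny _ yi'; first by rewrite -wi'.
    by apply: contraTeq jlt => JJ; rewrite -wi' wE upd_neq // ltxx.
  rewrite ii' in yi'.
  suff /(_ i) : prod_le w z by rewrite -yzi leNgt yi'.
  apply/phi_emb => //; rewrite wE; apply: upd_le; last by lra.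
  by move=> l _; exact: phi_mono.
have eqJ y z i : N y -> N z -> y 0 i = z 0 i -> phi y 0 (J i) = phi z 0 (J i).
  move=> Ny Nz yzi; pose w := \row_l Num.min (y 0 l) (z 0 l).
  have Nw : N w.
    move=> l; rewrite mxE; have := Ny l; have := Nz l.
    by have [?|?] := leP (y 0 l) (z 0 l).
  have wi : w 0 i = y 0 i by rewrite mxE yzi minxx.
  have wy : prod_le w y by move=> l; rewrite mxE ge_min lexx.
  have wz : prod_le w z by move=> l; rewrite mxE ge_min lexx orbT.
  by rewrite -(eqJ_le w y i) // -(eqJ_le w z i) // wi.
have ltJ y z i : N y -> N z -> y 0 i < z 0 i -> phi y 0 (J i) < phi z 0 (J i).
  move=> Ny Nz yzi; have Ny' := box_le_upd i Ny Nz.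
  have [lt _] := JP i y _ Ny Ny' yzi.
  by rewrite -(eqJ (upd y i (z 0 i)) z i) // upd_id.
split=> // [j|y z Ny Nz i].
  have [w [x [Nw wE yJx xle]]] := bump_ex j Np ltr01.
  have [i yi wi] := bump_single Np Nw wE yJx; exists i.
  have [|jlt _] := JP i p (w 0 i) Np _ yi; first by rewrite -wi.
  by apply: contraTeq jlt => JJ; rewrite -wi wE upd_neq // ltxx.
have [yz|yz|yz] := ltgtP (y 0 i) (z 0 i).
- by rewrite ltW // ltJ.
- by apply/esym/negbTE; rewrite -ltNge ltJ.
- by rewrite (eqJ y z i) // lexx.
Qed.

End LocalCoordinates.

(** * Enumerating a discrete and cofinal set of reals *)

Section Enumeration.
Variable R : realType.

Definition discrete_set (T : R -> Prop) := forall r, exists2 d, 0 < d &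
  forall t, T t -> `|t - r| < d -> t = r.

Definition two_sided (T : R -> Prop) :=
  forall r, exists a b, [/\ T a, T b & a <= r <= b].

Lemma discrete_setN T : discrete_set T -> discrete_set (T \o -%R).
Proof.
move=> dT r; have [d d0 dP] := dT (- r); exists d => // t Tt tr.
by apply/oppr_inj/dP => //; rewrite -opprD normrN.
Qed.

Lemma two_sidedN T : two_sided T -> two_sided (T \o -%R).
Proof.
move=> bT r; have [a [b [Ta Tb ab]]] := bT (- r).
by exists (- b), (- a); rewrite /= !opprK; split=> //; lra.
Qed.

Lemma next_ex T r : discrete_set T -> two_sided T ->
  exists s, [/\ r < s, T s & forall w, r < w -> w < s -> ~ T w].
Proof.
move=> dT bT; pose E : set R := [set t | T t /\ r < t].
have infE : has_inf E.
  split; last by exists r => t [_ /ltW].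
  by have [a [b [_ Tb rb]]] := bT (r + 1); exists b; split=> //; lra.
have lbE t : E t -> inf E <= t by move=> Et; apply: ge_inf => //; exact: infE.2.
have [d d0 dP] := dT (inf E); have [e [Te re] ed] := inf_adherent d0 infE.
have le_e := lbE e (conj Te re).
have eE : e = inf E by apply: dP => //; rewrite ger0_norm; lra.
exists e; split=> // w rw we Tw; have := lbE w (conj Tw rw); lra.
Qed.

(** An increasing and bounded sequence would accumulate at its supremum. *)
Lemma discrete_unbounded T (u : nat -> R) : discrete_set T ->
  (forall n, T (u n)) -> (forall n, u n < u n.+1) ->
  forall r, exists n, r < u n.
Proof.
move=> dT Tu uS r; apply: contrapT => /forallNP ur.
have supu : has_sup (range u).
  split; first by exists (u 0%N), 0%N.
  by exists r => _ [n _ <-]; rewrite leNgt; exact/negP/ur.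
have ub n : u n <= sup (range u) by apply: ub_le_sup; [exact: supu.2|exists n].
have [d d0 dP] := dT (sup (range u)).
have [_ [n _ <-] nd] := sup_adherent d0 supu.
have eq_sup k : sup (range u) - d < u k -> u k = sup (range u).
  by move=> kd; apply: dP => //; have := ub k; rewrite ltr_norml; lra.
have := uS n; rewrite (eq_sup n nd) eq_sup ?ltxx //.
by have := uS n; lra.
Qed.

(** The enumeration iterates the successor and the predecessor in [T] from an
    arbitrary element; it reaches every real because it is unbounded in both
    directions. *)
Lemma discrete_enum T : discrete_set T -> two_sided T ->
  exists t : int -> R, [/\ forall z, T (t z), forall z, t z < t (z + 1),
    forall r, exists z, t z <= r < t (z + 1)
  & forall r, T r -> exists z, r = t z].
Proof.
move=> dT bT; have dTN := discrete_setN dT; have bTN := two_sidedN bT.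
pose S r := projT1 (cid (next_ex r dT bT)).
have SP r : [/\ r < S r, T (S r) & forall w, r < w -> w < S r -> ~ T w].
  by rewrite /S; case: cid.
pose Q r := - projT1 (cid (next_ex (- r) dTN bTN)).
have QP r : [/\ Q r < r, T (Q r) & forall w, Q r < w -> w < r -> ~ T w].
  rewrite /Q; case: cid => s /= [rs Ts sP]; split=> //; first lra.
  by move=> w sw wr Tw; apply: (sP (- w)); rewrite ?opprK //; lra.
have SQ r : T r -> S (Q r) = r.
  move=> Tr; have [lt1 _ no1] := SP (Q r); have [lt2 T2 no2] := QP r.
  apply/le_anti; rewrite !leNgt; apply/andP; split; apply/negP => lt.
    exact: no1 _ lt2 lt Tr.
  by have [_ TS _] := SP (Q r); exact: no2 lt1 lt TS.
have [t0 [_ [Tt0 _ _]]] := bT 0.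
pose t z := match z with Posz k => iter k S t0 | Negz k => iter k.+1 Q t0 end.
have Tt z : T (t z).
  by case: z => [[|k]|k] //=; [have [] := SP (iter k S t0)|
     have [] := QP (iter k Q t0)].
have St z : t (z + 1) = S (t z).
  case: z => [k|[|k]]; first by rewrite addrC -intS.
    by rewrite /= SQ.
  have -> : Negz k.+1 + 1 = Negz k by lia.
  by rewrite [t (Negz k.+1)]/= SQ //; exact: (Tt (Negz k)).
have tS z : t z < t (z + 1) by rewrite St; have [] := SP (t z).
have t_floor r : exists z, t z <= r < t (z + 1).
  have [m rm] : exists m : nat, r < t m.
    exact: (discrete_unbounded (u := fun k => iter k S t0) dT
      (fun k => Tt k) (fun k => (let: And3 lt _ _ := SP (iter k S t0) in lt))).
  have [m' rm'] : exists m' : nat, - r < - iter m' Q t0.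
    apply: (discrete_unbounded (u := fun k => - iter k Q t0) dTN) => k.
      rewrite /= opprK; case: k => [//|k]; exact: (Tt (Negz k)).
    by rewrite ltrN2; have [] := QP (iter k Q t0).
  have m'P : iter m' Q t0 = t (- m'%:Z) by case: (m').
  have ex : exists k : nat, r < t (- m'%:Z + k%:Z).
    by exists (m' + m)%N; rewrite PoszD addKr.
  case: (ex_minnP ex) => -[|k] rk kmin.
    by move: rk; rewrite addr0 -m'P; lra.
  exists (- m'%:Z + k%:Z).
  have -> : - m'%:Z + k%:Z + 1 = - m'%:Z + k.+1%:Z by lia.
  rewrite rk andbT.
  by rewrite leNgt; apply/negP => /kmin; rewrite ltnn.
exists t; split=> // r Tr; have [z /andP[zr rz]] := t_floor r; exists z.
apply/le_anti; rewrite zr andbT leNgt; apply/negP => lt.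
by have [_ _] := SP (t z); rewrite -St => /(_ r lt rz).
Qed.

Lemma step_homo (t : int -> R) : (forall z, t z < t (z + 1)) ->
  {homo t : z w / z < w}.
Proof.
move=> tS z w zw; have -> : w = z + `|w - z|%N%:Z by lia.
have : (0 < `|w - z|)%N by lia.
elim: `|w - z|%N => // -[|k] IH _; first exact: tS.
have -> : z + k.+2%:Z = z + k.+1%:Z + 1 by lia.
exact: lt_trans (IH isT) (tS _).
Qed.

End Enumeration.

(** * Directed paths along straight segments *)

Section Dipaths.
Variables (R : realType) (P : precubical).
Local Notation X := (realization R P).

Lemma open_cube_open k : open (@open_cube R k).
Proof.
rewrite openE => t to; apply/nbhs_box.
have [i|e e0 elb] :=
    @finite_pos_lb R 'I_k (fun i => Num.min (t 0 i) (1 - t 0 i)).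
  by rewrite lt_min; have := to i; lra.
exists e => // u tu i; have := elb i; have := tu i.
by rewrite le_min ltr_norml; lra.
Qed.

Lemma box_open k (t : 'rV[R]_k) d : open (box t d).
Proof.
rewrite openE => u tu; apply/nbhs_box.
have [i|e e0 elb] := @finite_pos_lb R 'I_k (fun i => d - `|u 0 i - t 0 i|).
  by rewrite subr_gt0.
exists e => // v uv i.
rewrite -(subrK (u 0 i) (v 0 i)) -addrA (le_lt_trans (ler_normD _ _)) //.
by have := elb i; have := uv i; lra.
Qed.

Lemma continuous01P (Y : topologicalType) (h : R -> Y) :
  {within `[0, 1], continuous h} <-> forall s, 0 <= s <= 1 ->
    forall U, nbhs (h s) U -> exists2 e : R, 0 < e &
      forall a, 0 <= a <= 1 -> `|a - s| < e -> U (h a).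
Proof.
split=> [/subspace_continuousP hc s s01 U hU|H].
  have /(_ U hU)/nbhs_ballP[e /= e0 eU] := hc s s01.
  by exists e => // a a01 sa; apply: eU; rewrite // /ball /= distrC.
apply/subspace_continuousP => s; rewrite /= in_itv /= => s01 U hU.
have [e e0 eU] := H s s01 U hU; apply/nbhs_ballP; exists e => //= a.
by rewrite /ball /= distrC in_itv /= => sa a01; exact: eU.
Qed.

Lemma char_seg_continuous k (c : P k) (t u : 'rV[R]_k) :
  closed_cube t -> closed_cube u ->
  {within `[0, 1], continuous (fun s : R => char_map c (seg t u s))}.
Proof.
move=> tc uc; apply/continuous01P => s s01 U.
rewrite nbhsE => -[V [oV Vs] VU].
have [d d0 dV] := (realization_openP V).1 oV _ c _ (seg_closed tc uc s01) Vs.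
have [e e0 eP] := seg_continuous t u d0.
by exists e => // a a01 sa; apply/VU/dV; [exact: seg_closed|exact: eP].
Qed.

Lemma dipath_seg k (c : P k) (t u : 'rV[R]_k) (B : set X) :
  open_cube t -> open_cube u -> prod_le t u ->
  (forall s, 0 <= s <= 1 -> B (char_map c (seg t u s))) ->
  dipath_in B (char_map c t) (char_map c u).
Proof.
move=> to uo tu Bs; exists (fun s => char_map c (seg t u s)); split=> //.
- by apply: char_seg_continuous; exact: open_closed.
- by rewrite seg0.
- by rewrite seg1.
move=> k' c' a b a0 ab b1 c'ab t' u' ta ub.
have [sa sb] : open_cube (seg t u a) /\ open_cube (seg t u b).
  by split; apply: seg_open => //; lra.
have /cellP : cell (Cube c') (char_map c (seg t u a)) by exists t'.
rewrite (cell_of_char c sa) => cc'.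
have kk' : k = k' by case: cc'.
case: _ / kk' c' t' u' ta ub cc' {c'ab} => c' t' u' ta ub /Cube_inj cc'.
rewrite -cc' in ta ub.
rewrite (at_coord_inj ta (char_map_open c sa)).
rewrite (at_coord_inj ub (char_map_open c sb)) => i; rewrite !segE.
by have := tu i; nra.
Qed.

Lemma subpath (B : set X) (h : R -> X) a b : 0 <= a -> a <= b -> b <= 1 ->
  {within `[0, 1], continuous h} -> (forall s, 0 <= s <= 1 -> B (h s)) ->
  increasing_on_cubes h -> dipath_in B (h a) (h b).
Proof.
move=> a0 ab b1 hc hB hincr.
have in01 s : 0 <= s <= 1 -> 0 <= a + s * (b - a) <= 1 by nra.
exists (fun s => h (a + s * (b - a))); split.
- apply/continuous01P => s /in01 s01 U hU.
  have [e e0 eU] := (continuous01P h).1 hc _ s01 U hU.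
  exists e => // r /in01 r01 sr; apply: eU => //.
  apply: le_lt_trans sr; have -> : a + r * (b - a) - (a + s * (b - a)) =
    (r - s) * (b - a) by lra.
  by rewrite normrM ler_piMr // ger0_norm; lra.
- by rewrite mul0r addr0.
- by rewrite mul1r addrC subrK.
- by move=> s /in01; exact: hB.
move=> k c s r s0 sr r1 hsr t u; apply: hincr; [by nra..|].
move=> w /andP[sw wr].
have [ab'|] := eqVneq a b.
  suff -> : w = a + s * (b - a) by apply: hsr; rewrite lexx.
  by move: sw wr; rewrite ab' subrr !mulr0; lra.
rewrite eq_le ab /= -ltNge => altb.
have -> : w = a + (w - a) / (b - a) * (b - a).
  by rewrite divfK; [lra|apply/eqP; lra].
by apply: hsr; rewrite ler_pdivlMr ?ler_pdivrMr; lra.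
Qed.

End Dipaths.

(** * Cubes are boxes *)

(** This is the standard example of a poset of order dimension [k].  The point
    [up i], with only the [i]-th coordinate equal to [b], is not below the point
    [dn i], with only the [i]-th coordinate equal to [a], while it is below all
    the other points [dn l]; a coordinate of [phi] that witnesses the former for
    [i] hence cannot witness it for another index. *)
Lemma order_dimension (R : realType) k n (phi : 'rV[R]_k -> 'rV[R]_n)
    (a b : R) :
  a < b ->
  (forall y z : 'rV[R]_k, (forall i, a <= y 0 i <= b) ->
     (forall i, a <= z 0 i <= b) ->
     (prod_le (phi y) (phi z) <-> prod_le y z)) ->
  (k <= n)%N.
Proof.
move=> ab emb; pose up i := upd (const_mx a : 'rV[R]_k) i b.
pose dn i := upd (const_mx b : 'rV[R]_k) i a.
have in_upd x y i l : a <= x <= b -> a <= y <= b ->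
    a <= upd (const_mx x : 'rV[R]_k) i y 0 l <= b.
  by move=> xab yab; have [->|li] := eqVneq l i; rewrite ?upd_id ?upd_neq ?mxE.
have up_in i l : a <= up i 0 l <= b by apply: in_upd; rewrite lexx ltW.
have dn_in i l : a <= dn i 0 l <= b by apply: in_upd; rewrite lexx ltW.
have up_dn i l : i != l -> prod_le (phi (up i)) (phi (dn l)).
  move=> il; apply/emb => // j; rewrite /up /dn.
  have [->|ji] := eqVneq j i; first by rewrite upd_id upd_neq ?mxE.
  rewrite upd_neq // mxE; have [->|jl] := eqVneq j l; first by rewrite upd_id.
  by rewrite upd_neq // mxE ltW.
have ex i : exists j, phi (dn i) 0 j < phi (up i) 0 j.
  apply: contrapT => /forallNP nlt.
  suff /(_ i) : prod_le (up i) (dn i) by rewrite !upd_id leNgt ab.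
  by apply/emb => // j; rewrite leNgt; exact/negP/nlt.
pose J i := projT1 (cid (ex i)).
have JP i : phi (dn i) 0 (J i) < phi (up i) 0 (J i) by rewrite /J; case: cid.
suff Jinj : injective J by have := leq_card J Jinj; rewrite !card_ord.
move=> i l il; apply/eqP; apply: contraT => Nil.
have := JP i; have := JP l; rewrite -il.
have := up_dn _ _ Nil (J i); rewrite eq_sym in Nil; have := up_dn _ _ Nil (J i).
lra.
Qed.

Section Charts.
Variables (R : realType) (n : nat) (P : precubical).
Local Notation X := (realization R P).
Variables (L : ordered_base X) (f : X -> 'rV[R]_n) (g : 'rV[R]_n -> X).
Hypothesis loL : is_lo_realization L.
Hypothesis f_lo : lo_morphism L (Rn_base R n) f.
Hypothesis g_lo : lo_morphism (Rn_base R n) L g.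
Hypothesis fK : cancel f g.
Hypothesis gK : cancel g f.

Lemma f_open (U : set X) : open U -> open (f @` U).
Proof.
move=> oU; have -> : f @` U = g @^-1` U.
  apply/seteqP; split=> [_ [x Ux <-]|y Uy] /=; first by rewrite fK.
  by exists (g y).
by move/continuousP: g_lo.1; exact.
Qed.

(** As both [f] and [g] preserve the order locally, [f] is locally an order
    embedding; passing to an element of the base, and not only to an ordered
    open set, gives access to the description of the order by paths. *)
Lemma chart p (W : set X) : open W -> W p -> exists2 B, base_elt L B &
  [/\ carrier B p, carrier B `<=` W
    & forall x y, carrier B x -> carrier B y ->
        (ple B x y <-> prod_le (f x) (f y))].
Proof.
move=> oW Wp; pose VT := induced_poset (@prod_le_refl R n)
  (@prod_le_antisym R n) (@prod_le_trans R n) setT.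
have VTo : ordered_nbhd (Rn_base R n) (f p) VT.
  split=> //; split; first exact: openT.
  by exists VT => //; exists setT => //; exact: openT.
have [U1 [[[oU1 [B1 B1L [U1B1 sub1]]] U1p] _ U1f]] := f_lo.2 p VT VTo.
have U1nb : ordered_nbhd L (g (f p)) U1.
  by rewrite fK; split=> //; split=> //; exists B1.
have [U2 [[[oU2 [_ [V2 oV2 ->] [U2V2 sub2]]] U2p] gU2 U2g]] := g_lo.2 _ _ U1nb.
have oU2' : open (f @^-1` carrier U2) by move/continuousP: f_lo.1; exact.
have oW' : open (W `&` f @^-1` carrier U2) by exact: openI.
have [|_ [[B2 B2L <-] B2p] B2W] :=
    (base_basis L).2 p (W `&` f @^-1` carrier U2).
  exact: open_nbhs_nbhs.
have [B3 [B3L B3p [B31 sub3] [B32 _]]] :=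
  base_directed B1L B2L (U1B1 _ U1p) B2p.
exists B3 => //; split=> // [x /B32/B2W[]//|x y B3x B3y].
have U2x : carrier U2 (f x) by have [] := B2W _ (B32 _ B3x).
have U2y : carrier U2 (f y) by have [] := B2W _ (B32 _ B3y).
have gU1 z : carrier U2 (f z) -> carrier U1 z.
  by move=> U2z; rewrite -[z]fK; apply: gU2; exists (f z).
rewrite sub3 // -sub1; try exact: gU1.
split=> [|xy]; first by move/U1f; apply; exact: gU1.
by have := U2g _ _ U2x U2y; rewrite !fK; apply; apply/sub2.
Qed.

Lemma base_open B : base_elt L B -> open (carrier B).
Proof. by move=> BL; apply: (base_basis L).1; exists B. Qed.

Lemma minimum_ex k (c : P k) : exists v : P 0%N,
  is_minimum v (Cube c) /\ is_vertex v (char_map c (const_mx 0 : 'rV[R]_k)).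
Proof.
elim: k c => [|k IH] c.
  exists c; split; first exact: is_face_refl.
  by exists (const_mx 0); apply: char_map_open; case.
have [v [vmin vv]] := IH (face false ord0 c : P k); exists v; split.
  exact: (@is_face_step _ _ _ _ _ false ord0).
rewrite (@char_face _ _ _ _ _ ord0 false) ?mxE //.
by have -> : col' ord0 (const_mx 0) = const_mx 0 :> 'rV[R]_k
  by apply/rowP => i; rewrite !mxE.
Qed.

(** Near the minimum vertex of [c], a directed path that starts in the open
    cell of [c] only meets cubes that have [c] as a lower face, and it can only
    come back to [c] from cubes that are lower faces of [c]; so it stays in [c]
    if it ends there.  Close to that vertex, the order on the open cell of [c]
    is therefore the order of the coordinates, and [order_dimension] applies. *)
Lemma dim_le k (c : P k) : (k <= n)%N.
Proof.
have [v [vmin vv]] := minimum_ex c.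
have [B BL [B0 _ Bf]] := chart openT (I : setT (char_map c (const_mx 0))).
have Bnb : ordered_nbhd L (char_map c (const_mx 0)) B.
  split=> //; split; first exact: base_open.
  by exists B => //; split.
have [|d d0 dB] := (realization_openP _).1 (base_open BL) k c _ _ B0.
  by apply: const_closed; rewrite lexx ler01.
(* All the points with coordinates between h/3 and h/2 lie in the open cube
   and close enough to its minimum to be sent in B. *)
pose h := Num.min d 1.
have [h0 hd h1] : [/\ 0 < h, h <= d & h <= 1].
  by rewrite /h; have [?|?] := leP d 1; split; lra.
apply: (@order_dimension R k n (f \o char_map c) (h / 3) (h / 2)); first lra.
move=> t u tI uI /=.
have to : open_cube t by move=> i; have := tI i; lra.
have uo : open_cube u by move=> i; have := uI i; lra.
have Bs (w : 'rV[R]_k) : (forall i, h / 3 <= w 0 i <= h / 2) ->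
    carrier B (char_map c w).
  move=> wI; apply: dB => i; first by have := wI i; lra.
  by rewrite mxE subr0 ger0_norm; have := wI i; lra.
have Bt := Bs t tI; have Bu := Bs u uI.
rewrite -Bf // (order_of_paths loL BL) //.
split=> [[p [pc p0 p1 pB pincr]]|tu]; last first.
  by apply: dipath_seg => // s s01; apply: Bs => i; apply: seg_mid.
have sub a b : 0 <= a -> a <= b -> b <= 1 -> ple B (p a) (p b).
  move=> a0 ab b1; apply/(order_of_paths loL BL); [by apply: pB; lra..|].
  exact: subpath pincr.
have ct : cell (Cube c) (char_map c t) by exists t; exact: char_map_open.
have cu : cell (Cube c) (char_map c u) by exists u; exact: char_map_open.
apply: (pincr k c 0 1); rewrite ?p0 ?p1; try exact: char_map_open; try lra.
move=> s s01.
have Bps : carrier B (p s) by exact: pB.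
have [|c1 c1s cc1] := nbhd_above loL vv Bnb vmin Bt ct Bps.
  by rewrite -p0; apply: sub; lra.
have {}cc1 : lower_face (Cube c) c1.
  by case: cc1 => [//|->]; exact: is_face_refl.
have vmin1 : is_minimum v c1 by exact: is_face_trans vmin cc1.
have [|c2 c2u c12] := nbhd_above loL vv Bnb vmin1 Bps c1s Bu.
  by rewrite -p1; apply: sub; lra.
have {}c12 : lower_face c1 c2 by case: c12 => [//|->]; exact: is_face_refl.
have c2c : c2 = Cube c by move/cellP: c2u => <-; move/cellP: cu.
rewrite c2c in c12; have [->//|lt1] := is_face_dim cc1.
by have [<-//|lt2] := is_face_dim c12; move: lt1 lt2 => /=; lia.
Qed.

Lemma maximal_coface k (c : P k) : exists k' (d : P k'),
  is_face predT (Cube c) (Cube d) /\ maximal d.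
Proof.
move: {2}(n - k)%N (leqnn (n - k)) => m; elim: m k c => [|m IH] k c nk.
  exists k, c; split; first exact: is_face_refl.
  move=> [k' d] /is_face_dim[//|/= kk']; have := dim_le d; lia.
have [cmax|] := pselect (maximal c).
  by exists k, c; split=> //; exact: is_face_refl.
move=> /existsNP[[k' d]] /not_implyP[cd cNd].
have [//|/= kk'] := is_face_dim cd; have := dim_le d => k'n.
have [|k2 [d2 [dd2 d2max]]] := IH k' d; first by lia.
by exists k2, d2; split=> //; exact: is_face_trans cd dd2.
Qed.

(** ** Maximal cubes *)

Lemma box_conv k (t : 'rV[R]_k) d y z s : box t d y -> box t d z ->
  0 <= s <= 1 -> box t d (seg y z s).
Proof.
move=> ty tz s01 i.
have btw w : box t d w -> t 0 i - d < w 0 i < t 0 i + d.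
  by move=> /(_ i); rewrite ltr_norml; lra.
have := seg_mid_lt s01 (btw y ty) (btw z tz).
by rewrite ltr_norml; lra.
Qed.

Definition local_coord k (c : P k) (J : 'I_k -> 'I_n) (t : 'rV[R]_k) : Prop :=
  exists2 d, 0 < d & box t d `<=` @open_cube R k /\
    forall y z, box t d y -> box t d z -> forall i,
      (y 0 i <= z 0 i) =
      (f (char_map c y) 0 (J i) <= f (char_map c z) 0 (J i)).

Lemma maximal_local k (c : P k) (t : 'rV[R]_k) : maximal c -> open_cube t ->
  exists J : 'I_k -> 'I_n,
    [/\ injective J, forall j, exists i, J i = j & local_coord c J t].
Proof.
move=> cmax to.
have oc : open (char_map c @` @open_cube R k).
  by apply: open_maximal => //; exact: open_cube_open.
have [|B BL [Bt Bc Bf]] := chart (p := char_map c t) oc; first by exists t.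
have [d1 d10 dB] :=
  (realization_openP _).1 (base_open BL) k c t (open_closed to) Bt.
have /nbhs_box[d2 d20 dO] : nbhs t (@open_cube R k).
  by apply: open_nbhs_nbhs; split=> //; exact: open_cube_open.
pose d := Num.min d1 d2.
have [d0 dd1 dd2] : [/\ 0 < d, d <= d1 & d <= d2].
  by rewrite /d; have [?|?] := leP d1 d2; split; lra.
have NO y : box t d y -> open_cube y.
  by move=> ty; apply: dO => i; exact: lt_le_trans (ty i) dd2.
have NB y : box t d y -> carrier B (char_map c y).
  move=> ty; apply: dB; first exact/open_closed/NO.
  by move=> i; exact: lt_le_trans (ty i) dd1.
have cB p : carrier B p -> cell (Cube c) p.
  by move=> /Bc[u uo <-]; exists u; exact: char_map_open.
have emb y z : box t d y -> box t d z ->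
    (prod_le (f (char_map c y)) (f (char_map c z)) <-> prod_le y z).
  move=> ty tz; have By := NB y ty; have Bz := NB z tz.
  rewrite -Bf // (order_of_paths loL BL) //.
  split=> [[p [pc p0 p1 pB pincr]]|yz].
    apply: (pincr k c 0 1); rewrite ?p0 ?p1 //; try by apply/char_map_open/NO.
    by move=> s s01; apply/cB/pB.
  apply: dipath_seg => //; [exact: NO..|move=> s s01].
  by apply: NB; exact: box_conv.
have opn y : box t d y -> exists2 e : R, 0 < e &
    forall w, box (f (char_map c y)) e w ->
      exists2 z, box t d z & f (char_map c z) = w.
  move=> ty.
  have : nbhs (f (char_map c y)) (f @` (char_map c @` box t d)).
    apply: open_nbhs_nbhs; split; last by exists (char_map c y) => //; exists y.
    by apply: f_open; apply: open_maximal => //; exact: box_open.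
  by move=> /nbhs_box[e e0 eP]; exists e => // w /eP[_ [z tz <-] <-]; exists z.
have [J [Jinj Jsurj JP]] :=
  @local_coordinates R k n (f \o char_map c) t d d0 emb opn.
by exists J; split=> //; exists d.
Qed.

Lemma local_coord_uniq k (c : P k) J J' (t : 'rV[R]_k) :
  injective J -> (forall j, exists i, J' i = j) ->
  local_coord c J t -> local_coord c J' t -> J = J'.
Proof.
move=> Jinj J'surj [d d0 [_ dJ]] [d' d'0 [_ dJ']]; apply/funext => i.
have [l Jl] := J'surj (J i); rewrite -Jl; congr J'.
pose e := Num.min d d'.
have [e0 ed ed'] : [/\ 0 < e, e <= d & e <= d'].
  by rewrite /e; have [?|?] := leP d d'; split; lra.
pose z := upd t i (t 0 i + e / 2).
have tz r : e <= r -> box t r z.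
  move=> er; apply: box_upd; first by apply: box_center; lra.
  by rewrite ltr_norml; lra.
have tt r : e <= r -> box t r t by move=> er; apply: box_center; lra.
have lt_tz : t 0 i < z 0 i by rewrite upd_id; lra.
have := dJ z t (tz d ed) (tt d ed) i; rewrite leNgt lt_tz /= -Jl.
rewrite -(dJ' z t (tz d' ed') (tt d' ed') l).
by have [//|li] := eqVneq l i; rewrite upd_neq // lexx.
Qed.

Lemma local_coord_near k (c : P k) J (t : 'rV[R]_k) : local_coord c J t ->
  exists2 d, 0 < d & forall u, box t d u -> local_coord c J u.
Proof.
move=> [d d0 [dO dJ]]; exists (d / 2); first by rewrite divr_gt0.
move=> u tu; exists (d / 2); first by rewrite divr_gt0.
have sub y : box u (d / 2) y -> box t d y.
  move=> uy i; have := uy i; have := tu i; rewrite !ltr_norml; lra.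
by split=> [y /sub/dO//|y z /sub ty /sub tz]; exact: dJ.
Qed.

(** The permutation [J] that describes [f] near a point is the same along
    segments, hence the same at all the points of the open cell. *)
Lemma maximal_coord k (c : P k) : maximal c -> exists J : 'I_k -> 'I_n,
  [/\ injective J, forall j, exists i, J i = j &
      forall t, open_cube t -> local_coord c J t].
Proof.
move=> cmax.
have ho : open_cube (const_mx (1 / 2) : 'rV[R]_k) by apply: const_open; lra.
have [J [Jinj Jsurj Jh]] := maximal_local cmax ho.
exists J; split=> // t to.
pose Q (x y : 'rV[R]_k) := local_coord c J x -> local_coord c J y.
suff : Q (const_mx (1 / 2)) t by exact.
apply: segment_induction => [x y z xy yz /xy/yz//|s s01].
have [J' [J'inj J'surj /local_coord_near[d d0 dJ']]] :=
  maximal_local cmax (seg_open ho to s01).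
exists d => // a b _ _ _ /dJ' Ja /dJ' Jb Ja'.
by rewrite (local_coord_uniq Jinj J'surj Ja' Ja).
Qed.

(** The middle condition says both that the [J i]-th coordinate of the image is
    a function of the [i]-th coordinate, and that this function is increasing.
    Together, the three conditions say that [f] sends the closed cube to a box
    with sides parallel to the axes. *)
Definition coordinatewise k (c : P k) (J : 'I_k -> 'I_n) : Prop :=
  [/\ injective J,
    forall t u, closed_cube t -> closed_cube u -> forall i,
      (t 0 i <= u 0 i) =
      (f (char_map c t) 0 (J i) <= f (char_map c u) 0 (J i))
  & forall t u, closed_cube t -> closed_cube u -> forall j,
      j \notin codom J -> f (char_map c t) 0 j = f (char_map c u) 0 j].

Lemma local_coord_le k (c : P k) (J : 'I_k -> 'I_n) :
  (forall t, open_cube t -> local_coord c J t) ->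
  forall t u, open_cube t -> open_cube u -> forall i,
  (t 0 i <= u 0 i) = (f (char_map c t) 0 (J i) <= f (char_map c u) 0 (J i)).
Proof.
move=> Jloc.
have eqJ t u i : open_cube t -> open_cube u -> t 0 i = u 0 i ->
    f (char_map c t) 0 (J i) = f (char_map c u) 0 (J i).
  move=> to uo tu.
  pose Q (x y : 'rV[R]_k) :=
    f (char_map c x) 0 (J i) = f (char_map c y) 0 (J i).
  apply: (@segment_induction _ _ t u Q) => [x y z|s s01]; first exact: etrans.
  have [d d0 [_ dJ]] := Jloc _ (seg_open to uo s01).
  exists d => // a b _ _ _ sa sb; apply/le_anti.
  by rewrite -!dJ // !segE tu; apply/andP; split; lra.
have ltJ t u i : open_cube t -> open_cube u -> t 0 i < u 0 i ->
    f (char_map c t) 0 (J i) < f (char_map c u) 0 (J i).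
  move=> to uo tu.
  pose Q (x y : 'rV[R]_k) := x = y \/
    f (char_map c x) 0 (J i) < f (char_map c y) 0 (J i).
  suff [tu'|//] : Q t u by move: tu; rewrite tu' ltxx.
  apply: segment_induction => [x y z [->//|xy] [<-|yz]|s s01].
  - by right.
  - by right; exact: lt_trans yz.
  have [d d0 [_ dJ]] := Jloc _ (seg_open to uo s01).
  exists d => // a b a0 ab b1 sa sb; have [->|aNb] := eqVneq a b; first by left.
  have {aNb}altb : a < b by rewrite lt_neqAle aNb.
  by right; rewrite ltNge -dJ // -ltNge !segE; nra.
move=> t u to uo i; have [tu|tu|tu] := ltgtP (t 0 i) (u 0 i).
- by rewrite ltW // ltJ.
- by apply/esym/negbTE; rewrite -ltNge ltJ.
- by rewrite (eqJ t u i) // lexx.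
Qed.

(** Moving towards the center of the cube brings points of the closed cube
    into the open cube without reversing the order of their coordinates. *)
Lemma char_approx k (c : P k) (t : 'rV[R]_k) (U : set 'rV[R]_n) :
  closed_cube t -> open U -> U (f (char_map c t)) ->
  exists2 e : R, 0 < e & forall s : R, 0 <= s -> s < e -> s <= 1 ->
    U (f (char_map c (seg t (const_mx (1 / 2)) s))).
Proof.
move=> tc oU Ut.
have oV : open (f @^-1` U) by move/continuousP: f_lo.1; exact.
have [d d0 dU] := (realization_openP _).1 oV k c t tc Ut.
have [e e0 eP] := seg_continuous t (const_mx (1 / 2)) d0.
exists e => // s s0 se s1; apply: dU.
  by apply: seg_closed => //; [apply: const_closed; lra|rewrite s0].
by have := eP 0 s; rewrite seg0 subr0 ger0_norm //; exact.
Qed.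

Lemma coord_open k (j : 'I_k) (a : R) :
  open [set y : 'rV[R]_k | y 0 j < a] /\ open [set y : 'rV[R]_k | a < y 0 j].
Proof.
split; rewrite openE => y /= ya; apply/nbhs_box.
  exists (a - y 0 j); first by rewrite subr_gt0.
  by move=> z yz /=; have := yz j; rewrite ltr_norml; lra.
exists (y 0 j - a); first by rewrite subr_gt0.
by move=> z yz /=; have := yz j; rewrite ltr_norml; lra.
Qed.

Lemma maximal_coordinatewise k (c : P k) : maximal c ->
  exists J, coordinatewise c J /\ forall j, exists i, J i = j.
Proof.
move=> cmax; have [J [Jinj Jsurj Jloc]] := maximal_coord cmax.
exists J; split=> //; split=> // [t u tc uc i|t u _ _ j]; last first.
  by have [i <-] := Jsurj j; rewrite codom_f.
have Jle := local_coord_le Jloc.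
have leJ y z l : closed_cube y -> closed_cube z -> y 0 l <= z 0 l ->
    f (char_map c y) 0 (J l) <= f (char_map c z) 0 (J l).
  move=> yc zc yz; rewrite leNgt; apply/negP => zy.
  pose a := (f (char_map c y) 0 (J l) + f (char_map c z) 0 (J l)) / 2.
  have [|e1 e10 e1P] := char_approx (c := c) zc (coord_open (J l) a).1.
    by rewrite /a /=; lra.
  have [|e2 e20 e2P] := char_approx (c := c) yc (coord_open (J l) a).2.
    by rewrite /a /=; lra.
  pose e := Num.min (Num.min e1 e2) 1.
  have [e0 ee1 ee2 e1'] : [/\ 0 < e, e <= e1, e <= e2 & e <= 1].
    rewrite /e; have [?|?] := leP e1 e2.
      by have [?|?] := leP e1 1; split; lra.
    by have [?|?] := leP e2 1; split; lra.
  have /= lez := e1P (e / 2); have /= ley := e2P (e / 2).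
  have so (w : 'rV[R]_k) : closed_cube w ->
      open_cube (seg w (const_mx (1 / 2)) (e / 2)).
    by move=> wc m; rewrite segE mxE; have := wc m; nra.
  have := Jle _ _ (so _ yc) (so _ zc) l.
  rewrite leNgt (_ : (_ < _) = false) /=; last first.
    by apply/negbTE; rewrite -leNgt !segE !mxE; nra.
  by move/esym; rewrite leNgt (lt_trans (lez _ _ _) (ley _ _ _)) //; lra.
have ltJ y z l : closed_cube y -> closed_cube z -> y 0 l < z 0 l ->
    f (char_map c y) 0 (J l) < f (char_map c z) 0 (J l).
  move=> yc zc yz.
  pose a := (2 * y 0 l + z 0 l) / 3; pose b := (y 0 l + 2 * z 0 l) / 3.
  have yl := yc l; have zl := zc l.
  have [ya ab bz] : [/\ y 0 l <= a, a < b & b <= z 0 l].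
    by rewrite /a /b; split; lra.
  have [a01 b01] : 0 < a < 1 /\ 0 < b < 1 by rewrite /a /b; split; lra.
  have ao := @const_open R k a a01; have bo := @const_open R k b b01.
  have lt_ab : f (char_map c (const_mx a)) 0 (J l) <
               f (char_map c (const_mx b)) 0 (J l).
    by rewrite ltNge -Jle // !mxE -ltNge.
  apply: le_lt_trans (leJ _ _ l yc (open_closed ao) _) _; first by rewrite mxE.
  apply: lt_le_trans lt_ab (leJ _ _ l (open_closed bo) zc _).
  by rewrite mxE.
apply/idP/idP; first exact: leJ.
by apply: contraTT; rewrite -!ltNge; exact: ltJ.
Qed.

(** ** All cubes *)

Lemma coordinatewise_face k (c : P k.+1) J e (i : 'I_k.+1) :
  coordinatewise c J ->
  coordinatewise (face e i c : P k) (fun l => J (lift i l)).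
Proof.
move=> [Jinj Jle Jcst].
split=> [l l' /Jinj/lift_inj//|t u tc uc l|t u tc uc j jJ].
  by rewrite -!char_insert -Jle ?insert_lift //; exact: insert_closed.
have tc' := insert_closed i e tc; have uc' := insert_closed i e uc.
rewrite -!char_insert.
have [/codomP[l jl]|] := boolP (j \in codom J); last first.
  by move=> ?; apply: Jcst.
have {jl}-> : j = J i.
  case: (unliftP i l) jl => [l' ->|-> //] jl.
  by case/negP: jJ; apply/codomP; exists l'.
by apply/le_anti; rewrite -!Jle // !insert_id lexx.
Qed.

Lemma coordinatewise_ex k (c : P k) : exists J, coordinatewise c J.
Proof.
have [k' [d [cd dmax]]] := maximal_coface c.
have [J [Jd _]] := maximal_coordinatewise dmax.
pose Qd (x : cube P) := exists J, coordinatewise (projT2 x) J.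
suff : Qd (Cube c) by [].
have : Qd (Cube d) by exists J.
elim: cd => // x m y e i _ _ IH [J' J'y]; apply: IH.
case: m y i J' J'y => [|m] y i J' J'y; first by case: i.
by exists (fun l => J' (lift i l)); exact: coordinatewise_face.
Qed.

Lemma coordinatewise_uniq k (c : P k) J J' :
  coordinatewise c J -> coordinatewise c J' -> J = J'.
Proof.
move=> [Jinj Jle Jcst] [J'inj J'le J'cst]; apply/funext => i.
pose t : 'rV[R]_k := const_mx 0; pose u := upd t i 1.
have tc : closed_cube t by apply: const_closed; rewrite lexx ler01.
have uc : closed_cube u.
  move=> l; have [->|li] := eqVneq l i; first by rewrite upd_id ler01 lexx.
  by rewrite upd_neq.
have lt_tu : (u 0 i <= t 0 i) = false by rewrite upd_id mxE ler10.
have [/codomP[l Jl]|Ji] := boolP (J i \in codom J'); last first.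
  by move: lt_tu; rewrite Jle // (J'cst u t uc tc _ Ji) lexx.
rewrite Jl; congr J'; apply/eqP; apply: contraFT lt_tu => li.
by rewrite Jle // Jl -J'le // upd_neq.
Qed.

(** ** The walls *)

Definition cube_dir k (c : P k) : 'I_k -> 'I_n :=
  projT1 (cid (coordinatewise_ex c)).

Lemma cube_dirP k (c : P k) : coordinatewise c (cube_dir c).
Proof. by rewrite /cube_dir; case: cid. Qed.

Lemma cube_dir_inj k (c : P k) : injective (cube_dir c).
Proof. by have [] := cube_dirP c. Qed.

Lemma cube_dir_le k (c : P k) (t u : 'rV[R]_k) i :
  closed_cube t -> closed_cube u ->
  (t 0 i <= u 0 i) = (f (char_map c t) 0 (cube_dir c i) <=
                      f (char_map c u) 0 (cube_dir c i)).
Proof. by have [_ H _] := cube_dirP c; move=> tc uc; exact: H. Qed.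

Lemma cube_dir_lt k (c : P k) (t u : 'rV[R]_k) i :
  closed_cube t -> closed_cube u ->
  (t 0 i < u 0 i) = (f (char_map c t) 0 (cube_dir c i) <
                     f (char_map c u) 0 (cube_dir c i)).
Proof. by move=> tc uc; rewrite !ltNge (@cube_dir_le _ c). Qed.

Lemma cube_dir_cst k (c : P k) (t u : 'rV[R]_k) j :
  closed_cube t -> closed_cube u -> j \notin codom (cube_dir c) ->
  f (char_map c t) 0 j = f (char_map c u) 0 j.
Proof. by have [_ _ H] := cube_dirP c; move=> tc uc; exact: H. Qed.

Lemma cube_dir_face k e (i : 'I_k) (c : P k) l :
  cube_dir (face e i c) l = cube_dir c (lift i l).
Proof.
case: k i c l => [|k] i c l; first by case: i.
have := coordinatewise_uniq (cube_dirP (face e i c : P k))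
  (coordinatewise_face e i (cube_dirP c)).
by move/(congr1 (@^~ l)).
Qed.

Definition free (c : cube P) (j : 'I_n) : bool :=
  j \in codom (cube_dir (projT2 c)).

Lemma free_face E (c d : cube P) j : is_face E c d -> free c j -> free d j.
Proof.
elim=> // c' k d' e i _ _ IH /IH /codomP[l ->]; rewrite /free /=.
by rewrite cube_dir_face codom_f.
Qed.

Lemma card_free (c : cube P) : #|free c| = projT1 c.
Proof.
rewrite -[RHS]card_ord -(card_codom (@cube_dir_inj _ (projT2 c))).
exact: eq_card.
Qed.

Lemma free_inj E (c d : cube P) : is_face E c d -> free c =1 free d -> c = d.
Proof.
move=> cd cdf; have [//|] := is_face_dim cd.
by rewrite -!card_free (eq_card cdf) ltnn.
Qed.

Lemma free_char k (c : P k) (t : 'rV[R]_k) i : closed_cube t ->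
  free (cell_of (char_map c t)) (cube_dir c i) = (0 < t 0 i < 1).
Proof.
elim: k c t i => [|k IH] c t i tc; first by case: i.
have [to|/(closed_not_open tc)[l [b tlb]]] := pselect (open_cube t).
  by rewrite cell_of_char // /free codom_f to.
rewrite (char_face c tlb); case: (unliftP l i) => [i' ->|->].
  rewrite -(cube_dir_face b l c) IH; last exact: col'_closed.
  by rewrite mxE.
transitivity false; last by rewrite tlb; case: (b); rewrite ?ltxx ?andbF.
apply: contraTF isT => /(free_face (cell_face _ (col'_closed l tc))).
move=> /codomP[i'] /=; have /= -> := cube_dir_face b l c i'.
move=> /cube_dir_inj/eqP.
by rewrite (negPf (neq_lift _ _)).
Qed.

Definition cell_at (x : 'rV[R]_n) : cube P := cell_of (g x).

Lemma cell_at_char k (c : P k) (t : 'rV[R]_k) :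
  cell_at (f (char_map c t)) = cell_of (char_map c t).
Proof. by rewrite /cell_at fK. Qed.

Lemma cell_at_near x : exists2 d : R, 0 < d &
  forall y, box x d y -> is_face predT (cell_at x) (cell_at y).
Proof.
have : nbhs x (g @^-1` [set p | is_face predT (cell_at x) (cell_of p)]).
  apply: open_nbhs_nbhs; split; last exact: is_face_refl.
  by move/continuousP: g_lo.1; apply; exact: open_star.
by move=> /nbhs_box.
Qed.

Lemma common_cube x y : is_face predT (cell_at x) (cell_at y) ->
  exists k (c : P k) t u, [/\ closed_cube t, closed_cube u,
    f (char_map c t) = x, f (char_map c u) = y &
    forall j, exists i, cube_dir c i = j].
Proof.
move=> xy; have [k [c [yc cmax]]] := maximal_coface (projT2 (cell_at y)).
have yc' : is_face predT (cell_at y) (Cube c).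
  by move: yc; rewrite /Cube; case: (cell_at y).
have [t tc tx] := closed_cell (is_face_trans xy yc').
have [u uc uy] := closed_cell yc'.
exists k, c, t, u; split; rewrite ?tx ?uy ?gK //.
have [J [Jc Jsurj]] := maximal_coordinatewise cmax.
by rewrite (coordinatewise_uniq (cube_dirP c) Jc).
Qed.

(** Both points lie in a closed maximal cube, where they have the same [j]-th
    coordinate, and [free_char] reads freeness off this coordinate. *)
Lemma free_near (x y : 'rV[R]_n) j : is_face predT (cell_at x) (cell_at y) ->
  x 0 j = y 0 j -> free (cell_at x) j = free (cell_at y) j.
Proof.
move=> /common_cube[k [c [t [u [tc uc <- <- csurj]]]]].
have [i <-] := csurj j; rewrite !cell_at_char !free_char // => tu.
suff -> : t 0 i = u 0 i by [].
by apply/le_anti; rewrite !(@cube_dir_le _ c) // tu lexx.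
Qed.

(** Hence the points where [j] is not free form a union of hyperplanes: on the
    segment from [x] to [y] the [j]-th coordinate is constant, so that
    [free_near] applies at each of its points. *)
Lemma free_hyperplane (x y : 'rV[R]_n) j : x 0 j = y 0 j ->
  free (cell_at x) j = free (cell_at y) j.
Proof.
move=> xy.
pose Q (a b : 'rV[R]_n) := free (cell_at a) j = free (cell_at b) j.
apply: (@segment_induction _ _ x y Q) => [a b c|s s01]; first exact: etrans.
have [d d0 dP] := cell_at_near (seg x y s); exists d => // a b _ _ _ sa sb.
by rewrite /Q -(free_near (dP _ sa)) -?(free_near (dP _ sb)) // !segE xy; lra.
Qed.

Definition wall (j : 'I_n) (r : R) : Prop :=
  ~~ free (cell_at (const_mx r)) j.

Lemma wallP (x : 'rV[R]_n) j : wall j (x 0 j) <-> ~~ free (cell_at x) j.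
Proof. by rewrite /wall (@free_hyperplane (const_mx (x 0 j)) x) ?mxE. Qed.

(** By the intermediate value theorem, [r] is the coordinate of the image of a
    point of [c] which is off the two faces of [c] in direction [i]. *)
Lemma no_wall k (c : P k) (t u : 'rV[R]_k) i r :
  closed_cube t -> closed_cube u ->
  f (char_map c t) 0 (cube_dir c i) < r ->
  r < f (char_map c u) 0 (cube_dir c i) -> ~ wall (cube_dir c i) r.
Proof.
move=> tc uc tr ru; set j := cube_dir c i in tr ru *.
pose h (s : R) := f (char_map c (seg t u s)) 0 j.
have hc : {within `[0, 1], continuous h}.
  apply/continuous01P => s s01 U hU.
  have := (continuous01P _).1 (char_seg_continuous (c := c) tc uc) s s01.
  move/(_ ((fun p => f p 0 j) @^-1` U)); apply.
  have : {for f (char_map c (seg t u s)),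
      continuous (fun y : 'rV[R]_n => y 0 j)}.
    exact: coord_continuous.
  by move=> /(continuous_comp (f_lo.1 _)); exact.
have [|s] := IVT ler01 hc (v := r).
  rewrite /h seg0 seg1 min_l ?max_r ?ltW //; exact: lt_trans ru.
rewrite in_itv /= => s01 hs; rewrite -hs /h wallP cell_at_char.
have sc := seg_closed tc uc s01.
rewrite free_char // => /negP; apply.
move: tr ru; rewrite -hs /h -!cube_dir_lt //.
by have := tc i; have := uc i; lra.
Qed.

(** A point [x] of height [r] and a point [y] a little above or below it lie in
    a common closed box, so that there is no wall strictly between them.  To
    exclude the height [w], the point [y] is taken at the height [2 * w - r]. *)
Lemma wall_discrete j : discrete_set (wall j).
Proof.
move=> r; pose x : 'rV[R]_n := const_mx r.
have [d d0 dP] := cell_at_near x; exists (d / 2); first by rewrite divr_gt0.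
move=> w ww; rewrite ltr_norml => wr; apply/eqP; apply: contraPT ww => wNr.
pose y := upd x j (2 * w - r).
have xy : is_face predT (cell_at x) (cell_at y).
  apply/dP/box_upd; first exact: box_center.
  by rewrite mxE ltr_norml; lra.
have [k [c [t [u [tc uc tx uy csurj]]]]] := common_cube xy.
have [i ij] := csurj j; rewrite -ij.
have xj : f (char_map c t) 0 (cube_dir c i) = r by rewrite tx mxE.
have yj : f (char_map c u) 0 (cube_dir c i) = 2 * w - r.
  by rewrite uy ij upd_id.
have [wr'|rw|wr'] := ltgtP w r; last by rewrite wr' eqxx in wNr.
  by apply: (no_wall uc tc); rewrite ?xj ?yj; lra.
by apply: (no_wall tc uc); rewrite ?xj ?yj; lra.
Qed.

(** Two opposite faces of a maximal box lie in walls. *)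
Lemma wall_two_sided j : two_sided (wall j).
Proof.
move=> r; pose x : 'rV[R]_n := const_mx r.
have [k [c [t [_ [tc _ tx _ csurj]]]]] :=
  common_cube (is_face_refl _ (cell_at x)).
have [i ij] := csurj j; rewrite -ij.
have c0 : closed_cube (const_mx 0 : 'rV[R]_k).
  by apply: const_closed; rewrite lexx ler01.
have c1 : closed_cube (const_mx 1 : 'rV[R]_k).
  by apply: const_closed; rewrite lexx ler01.
exists (f (char_map c (const_mx 0)) 0 (cube_dir c i)).
exists (f (char_map c (const_mx 1)) 0 (cube_dir c i)).
split; rewrite ?wallP ?cell_at_char ?free_char ?mxE ?ltxx ?andbF //.
have -> : r = f (char_map c t) 0 (cube_dir c i) by rewrite tx mxE.
by rewrite -!cube_dir_le // !mxE; exact: tc.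
Qed.

(** ** The labelling *)

Definition wall_at (j : 'I_n) : int -> R :=
  projT1 (cid (discrete_enum (wall_discrete j) (wall_two_sided j))).

Lemma wall_atP j : [/\ forall z, wall j (wall_at j z),
  {homo wall_at j : z w / z < w},
  forall r, exists z, wall_at j z <= r < wall_at j (z + 1)
  & forall r, wall j r -> exists z, r = wall_at j z].
Proof.
rewrite /wall_at; case: cid => t [Tt tS t_floor t_surj] /=; split=> //.
exact: step_homo.
Qed.

Lemma wall_at_wall j z : wall j (wall_at j z).
Proof. by have [] := wall_atP j. Qed.

Lemma wall_at_lt j z w : (wall_at j z < wall_at j w) = (z < w).
Proof.
have [_ h _ _] := wall_atP j.
exact: (leW_mono (le_mono h)).
Qed.

Lemma wall_floor_ex j r : exists z, wall_at j z <= r < wall_at j (z + 1).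
Proof. by have [] := wall_atP j. Qed.

Definition wall_floor j r : int := projT1 (cid (wall_floor_ex j r)).

Lemma wall_floorP j r :
  wall_at j (wall_floor j r) <= r < wall_at j (wall_floor j r + 1).
Proof. by rewrite /wall_floor; case: cid. Qed.

Lemma wall_floor_uniq j r z :
  wall_at j z <= r < wall_at j (z + 1) -> wall_floor j r = z.
Proof.
move=> /andP[zr rz]; have /andP[fr rf] := wall_floorP j r.
have := le_lt_trans zr rf; have := le_lt_trans fr rz; rewrite !wall_at_lt.
by lia.
Qed.

Lemma wall_at_floor j r : wall j r -> r = wall_at j (wall_floor j r).
Proof.
have [_ _ _ H] := wall_atP j; move=> /H[z ->]; congr wall_at.
by apply/esym/wall_floor_uniq; rewrite lexx wall_at_lt; lia.
Qed.

Lemma between_walls j r z :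
  wall_at j z < r -> r < wall_at j (z + 1) -> ~ wall j r.
Proof.
move=> zr rz /wall_at_floor rE; move: zr rz; rewrite rE !wall_at_lt; lia.
Qed.

Lemma wall_floor_lt j r : ~ wall j r -> wall_at j (wall_floor j r) < r.
Proof.
move=> nw; have /andP[fr _] := wall_floorP j r; rewrite lt_neqAle fr andbT.
by apply/eqP => rE; apply: nw; rewrite -rE; exact: wall_at_wall.
Qed.

Lemma wall_floor_const j r r' : r <= r' ->
  (forall w, r < w -> w <= r' -> ~ wall j w) ->
  wall_floor j r' = wall_floor j r.
Proof.
move=> rr' nw; have /andP[fr rf] := wall_floorP j r.
apply: wall_floor_uniq; rewrite (le_trans fr rr') /= ltNge; apply/negP => le.
exact: nw rf le (wall_at_wall _ _).
Qed.

Definition center k : 'rV[R]_k := const_mx (1 / 2).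

Lemma center_open k : open_cube (center k).
Proof. by apply: const_open; lra. Qed.

Definition cube_pos k (c : P k) (j : 'I_n) : int :=
  wall_floor j (f (char_map c (center k)) 0 j).

Lemma open_cell_floor k (c : P k) (t : 'rV[R]_k) j : open_cube t ->
  wall_floor j (f (char_map c t) 0 j) = cube_pos c j.
Proof.
move=> to; have cto := @center_open k; rewrite /cube_pos.
have [/codomP[i ->]|?] := boolP (j \in codom (cube_dir c)); last first.
  by rewrite (cube_dir_cst (u := center k)) //; exact: open_closed.
have aux (t1 t2 : 'rV[R]_k) : open_cube t1 -> open_cube t2 ->
    t1 0 i <= t2 0 i ->
    wall_floor (cube_dir c i) (f (char_map c t2) 0 (cube_dir c i)) =
    wall_floor (cube_dir c i) (f (char_map c t1) 0 (cube_dir c i)).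
  move=> t1o t2o; have [t1c t2c] := (open_closed t1o, open_closed t2o).
  have [c0 c1] : closed_cube (const_mx 0 : 'rV[R]_k) /\
                 closed_cube (const_mx 1 : 'rV[R]_k).
    by split; apply: const_closed; rewrite lexx ler01.
  rewrite (@cube_dir_le _ c) // => le12; apply: wall_floor_const => // w w1 w2.
  apply: (no_wall c0 c1).
    by apply: lt_trans w1; rewrite -cube_dir_lt // mxE; have := t1o i; lra.
  by apply: le_lt_trans w2 _; rewrite -cube_dir_lt // mxE; have := t2o i; lra.
have [le|/ltW le] := leP (t 0 i) (center k 0 i); first exact/esym/aux.
exact: aux.
Qed.

Lemma cube_pos_face k e (i : 'I_k) (c : P k) j :
  cube_pos (face e i c) j = cube_pos c j + (e && (j == cube_dir c i))%:R.
Proof.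
case: k i c => [|k] i c; first by case: i.
have oc := open_closed (@center_open k.+1).
have xc := insert_closed i e (open_closed (@center_open k)).
rewrite {1}/cube_pos -char_insert; set x := insert i _ _ in xc *.
have xi : x 0 i = e%:R by rewrite insert_id.
have [{j}->|ji] := eqVneq j (cube_dir c i); last first.
  rewrite andbF addr0 /cube_pos.
  have [/codomP[l jl]|?] := boolP (j \in codom (cube_dir c)); last first.
    by rewrite (cube_dir_cst xc oc).
  congr wall_floor; case: (unliftP i l) jl => [l' ->|->] jl; last first.
    by rewrite jl eqxx in ji.
  by rewrite jl; apply/le_anti; rewrite -!cube_dir_le // insert_lift !mxE lexx.
rewrite andbT; set j := cube_dir c i.
have wx : wall j (f (char_map c x) 0 j).
  by rewrite wallP cell_at_char free_char // xi; case: (e); rewrite ltxx ?andbF.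
have ci : center k.+1 0 i = 1 / 2 by rewrite mxE.
rewrite /cube_pos -/j; case: e @x xc xi wx => x xc xi wx /=; last first.
  have {}xi : x 0 i = 0 by [].
  rewrite addr0; apply/esym/wall_floor_const.
    by rewrite -cube_dir_le // xi ci; lra.
  move=> w xw wc; have c1 : closed_cube (const_mx 1 : 'rV[R]_k.+1).
    by apply: const_closed; rewrite lexx ler01.
  apply: (no_wall xc c1) => //; apply: le_lt_trans wc _.
  by rewrite -cube_dir_lt // ci mxE; lra.
have {}xi : x 0 i = 1 by [].
apply: wall_floor_uniq.
have /andP[cf fc] := wall_floorP j (f (char_map c (center k.+1)) 0 j).
have cx : f (char_map c (center k.+1)) 0 j < f (char_map c x) 0 j.
  by rewrite -cube_dir_lt // ci xi; lra.
set z := wall_floor _ _ in cf fc *.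
have -> : f (char_map c x) 0 j = wall_at j (z + 1).
  rewrite [LHS](wall_at_floor wx); congr wall_at; set w := wall_floor _ _.
  have xw : f (char_map c x) 0 j = wall_at j w by exact: wall_at_floor.
  have zw : z < w by rewrite -(wall_at_lt j) -xw; exact: le_lt_trans cx.
  suff : ~ (z + 1 < w) by lia.
  rewrite -(wall_at_lt j) -xw => lt.
  exact: (no_wall oc xc fc lt) (wall_at_wall _ _).
by rewrite lexx wall_at_lt; lia.
Qed.

(** All the points of the segment from [x] to [y] have the same free
    directions; as a cell that has the cell of such a point as a face and has
    the same free directions is equal to it, the cell is locally constant along
    the segment. *)
Lemma cell_at_inj (x y : 'rV[R]_n) : free (cell_at x) =1 free (cell_at y) ->
  (forall j, wall_floor j (x 0 j) = wall_floor j (y 0 j)) ->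
  cell_at x = cell_at y.
Proof.
move=> fxy pxy.
have fseg s j : 0 <= s <= 1 ->
    free (cell_at (seg x y s)) j = free (cell_at x) j.
  move=> s01; have [xj|xj] := boolP (free (cell_at x) j).
    apply: contrapT => /negP /wallP; set z := wall_floor j (x 0 j).
    have zP u : free (cell_at u) j -> wall_floor j (u 0 j) = z ->
        wall_at j z < u 0 j < wall_at j (z + 1).
      move=> uj uz; have /andP[_ uz1] := wall_floorP j (u 0 j).
      rewrite -uz uz1 andbT; apply: wall_floor_lt; rewrite wallP uj.
      by move=> /negP; exact.
    have yj : free (cell_at y) j by rewrite -fxy.
    have /andP[lt1 lt2] :=
      seg_mid_lt s01 (zP x xj erefl) (zP y yj (esym (pxy j))).
    exact: between_walls lt1 lt2.
  rewrite -(negbTE xj); apply: free_hyperplane.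
  have yj : ~~ free (cell_at y) j by rewrite -fxy.
  rewrite segE -(_ : x 0 j = y 0 j); first by lra.
  rewrite (wall_at_floor ((wallP x j).2 xj)) (wall_at_floor ((wallP y j).2 yj)).
  by rewrite pxy.
pose Q (a b : 'rV[R]_n) := cell_at a = cell_at b.
apply: (@segment_induction _ _ x y Q) => [a b c|s s01]; first exact: etrans.
have [d d0 dP] := cell_at_near (seg x y s); exists d => // a b a0 ab b1 sa sb.
have same r : 0 <= r <= 1 -> box (seg x y s) d (seg x y r) ->
    cell_at (seg x y s) = cell_at (seg x y r).
  by move=> r01 /dP/free_inj; apply => j; rewrite !fseg.
by rewrite /Q -!same //; lra.
Qed.

Lemma cube_label_inj k (c d : P k) :
  codom (cube_dir c) =i codom (cube_dir d) -> cube_pos c =1 cube_pos d -> c = d.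
Proof.
move=> cd pcd; apply: Cube_inj; have co := @center_open k.
rewrite -(cell_of_char c co) -(cell_of_char d co) -!cell_at_char.
apply: cell_at_inj => j; last exact: pcd.
by rewrite !cell_at_char !cell_of_char //; exact: cd.
Qed.

Lemma cube_label_surj k (a : 'I_k -> 'I_n) (z : 'I_n -> int) : injective a ->
  exists c : P k, codom (cube_dir c) =i codom a /\ cube_pos c =1 z.
Proof.
move=> a_inj.
pose x : 'rV[R]_n := \row_j if j \in codom a
  then (wall_at j (z j) + wall_at j (z j + 1)) / 2 else wall_at j (z j).
have zz j : wall_at j (z j) < wall_at j (z j + 1) by rewrite wall_at_lt; lia.
have xz j : wall_floor j (x 0 j) = z j.
  apply: wall_floor_uniq; rewrite mxE; case: ifP => _; have := zz j; lra.
have xf j : free (cell_at x) j = (j \in codom a).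
  apply/idP/idP; last first.
    move=> ja; apply: contrapT => /negP/wallP; rewrite mxE ja.
    by apply: between_walls; have := zz j; lra.
  apply: contraTT => ja; apply/wallP; rewrite mxE (negPf ja).
  exact: wall_at_wall.
have [k' [c [t [to xt]]]] := point_char (g x).
have cx : cell_at x = Cube c by rewrite /cell_at xt cell_of_char.
have kk' : k' = k.
  rewrite -[LHS]/(projT1 (Cube c)) -cx -card_free (eq_card xf).
  by rewrite (card_codom a_inj) card_ord.
case: _ / kk' a a_inj @x zz xz xf xt cx => a a_inj x zz xz xf xt cx.
exists c; split=> j; first by rewrite -xf cx.
by rewrite -(open_cell_floor c j to) -xt gK.
Qed.

Definition cube_labelling : grid_labelling P n :=
  GridLabelling cube_dir_inj cube_dir_face cube_pos_face
    cube_label_inj cube_label_surj.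

End Charts.

Theorem theorem5p18 (R : realType) (n : nat) (P : precubical)
    (L : ordered_base (realization R P)) :
  is_lo_realization L ->
  lo_isomorphic L (Rn_base R n) ->
  precubical_isomorphic P (tensor_power line n).
Proof.
move=> loL [f [g [f_lo g_lo fK gK]]].
apply: grid_labelling_iso (tensor_power_line_labelling n).
exact: cube_labelling loL f_lo g_lo fK gK.
Qed.
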